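(* Let $GML^n_p=(J^1(T,M),\,G^{(\alpha)(\beta)}_{(i)(j)}=h^{\alpha\beta}g_{ij})$ be a generalized metrical multi-time Lagrange space endowed with a nonlinear connection $\Gamma=(M^{(i)}_{(\alpha)\beta},N^{(i)}_{(\alpha)j})$. Then there is a unique $h$-normal $\Gamma$-linear connection $$C\Gamma=(H^\gamma_{\alpha\beta},G^k_{j\gamma},L^i_{jk},C^{i(\gamma)}_{j(k)})$$ having the properties i) $g_{ij|k}=0$ and $g_{ij}|^{(\gamma)}_{(k)}=0$; ii) $G^k_{j\gamma}=\dfrac{g^{ki}}{2}\dfrac{\delta g_{ij}}{\delta t^\gamma}$, $\;L^k_{ij}=L^k_{ji}$, $\;C^{i(\gamma)}_{j(k)}=C^{i(\gamma)}_{k(j)}$. Moreover, the coefficients $L^i_{jk}$ and $C^{i(\gamma)}_{j(k)}$ of this connection are $$L^i_{jk}=\frac{g^{im}}{2}\left(\frac{\delta g_{mj}}{\delta x^k}+\frac{\delta g_{mk}}{\delta x^j}-\frac{\delta g_{jk}}{\delta x^m}\right),\qquad C^{i(\gamma)}_{j(k)}=\frac{g^{im}}{2}\left(\frac{\partial g_{mj}}{\partial x^k_\gamma}+\frac{\partial g_{mk}}{\partial x^j_\gamma}-\frac{\partial g_{jk}}{\partial x^m_\gamma}\right).$$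
   Context: Setting. $T$ and $M$ are smooth real manifolds of dimensions $p$ and $n$, with local coordinates $(t^\alpha)$ and $(x^i)$; Greek indices run over $1,\dots,p$, Latin indices over $1,\dots,n$, and the summation convention is used. $E=J^1(T,M)\to T\times M$ is the first order jet bundle, with coordinates $(t^\alpha,x^i,x^i_\alpha)$ which change by $\tilde t^\alpha=\tilde t^\alpha(t^\beta)$, $\tilde x^i=\tilde x^i(x^j)$, $\tilde x^i_\alpha=\frac{\partial\tilde x^i}{\partial x^j}\frac{\partial t^\beta}{\partial\tilde t^\alpha}x^j_\beta$. A d-tensor on $E$ is a family of local functions on $E$ transforming tensorially: Greek indices with the Jacobian of $t\mapsto\tilde t$, Latin indices with that of $x\mapsto\tilde x$; indices in parentheses $(i),(\alpha)$ refer to vertical directions and transform in the same way according to their position. $h=(h_{\alpha\beta}(t))$ is a fixed semi-Riemannian metric on $T$ with inverse $h^{\alpha\beta}$ and Christoffel symbols $H^\gamma_{\alpha\beta}$. $g_{ij}(t^\gamma,x^k,x^k_\gamma)$ is a d-tensor on $E$, symmetric, of rank $n$, of constant signature, with inverse $g^{ij}$. The pair $GML^n_p=(E,\,G^{(\alpha)(\beta)}_{(i)(j)}=h^{\alpha\beta}g_{ij})$ is called a generalized metrical multi-time Lagrange space. Nonlinear connection. $\Gamma=(M^{(i)}_{(\alpha)\beta},N^{(i)}_{(\alpha)j})$ is a family of local functions on $E$ such that the vector fields $\frac{\delta}{\delta t^\alpha}=\frac{\partial}{\partial t^\alpha}-M^{(j)}_{(\beta)\alpha}\frac{\partial}{\partial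 x^j_\beta}$ and $\frac{\delta}{\delta x^i}=\frac{\partial}{\partial x^i}-N^{(j)}_{(\beta)i}\frac{\partial}{\partial x^j_\beta}$ transform tensorially. Together with $\frac{\partial}{\partial x^i_\alpha}$ they form the adapted basis of vector fields. $h$-normal $\Gamma$-linear connection. This is a linear connection $\nabla$ on $E$ determined by local functions $(H^\gamma_{\alpha\beta},G^k_{j\gamma},L^i_{jk},C^{i(\gamma)}_{j(k)})$, where $H^\gamma_{\alpha\beta}$ are the Christoffel symbols of $h$, through $\nabla_{\delta/\delta t^\gamma}\frac{\delta}{\delta t^\alpha}=H^\beta_{\alpha\gamma}\frac{\delta}{\delta t^\beta}$, $\nabla_{\delta/\delta x^k}\frac{\delta}{\delta t^\alpha}=0$, $\nabla_{\partial/\partial x^k_\gamma}\frac{\delta}{\delta t^\alpha}=0$; $\nabla_{\delta/\delta t^\gamma}\frac{\delta}{\delta x^j}=G^k_{j\gamma}\frac{\delta}{\delta x^k}$, $\nabla_{\delta/\delta x^k}\frac{\delta}{\delta x^j}=L^i_{jk}\frac{\delta}{\delta x^i}$, $\nabla_{\partial/\partial x^k_\gamma}\frac{\delta}{\delta x^j}=C^{i(\gamma)}_{j(k)}\frac{\delta}{\delta x^i}$; $\nabla_{\delta/\delta t^\gamma}\frac{\partial}{\partial x^i_\alpha}=G^k_{i\gamma}\frac{\partial}{\partial x^k_\alpha}-H^\alpha_{\eta\gamma}\frac{\partial}{\partial x^i_\eta}$, $\nabla_{\delta/\delta x^k}\frac{\partial}{\partial x^i_\alpha}=L^l_{ik}\frac{\partial}{\partial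 x^l_\alpha}$, $\nabla_{\partial/\partial x^k_\gamma}\frac{\partial}{\partial x^i_\alpha}=C^{l(\gamma)}_{i(k)}\frac{\partial}{\partial x^l_\alpha}$. Local covariant derivatives. For such a connection, $g_{ij|k}=\frac{\delta g_{ij}}{\delta x^k}-L^m_{ik}g_{mj}-L^m_{jk}g_{im}$ and $g_{ij}|^{(\gamma)}_{(k)}=\frac{\partial g_{ij}}{\partial x^k_\gamma}-C^{m(\gamma)}_{i(k)}g_{mj}-C^{m(\gamma)}_{j(k)}g_{im}$. *)

(* Defs.v *)
From HB Require Import structures.
From mathcomp Require Import all_boot all_order all_algebra.
From mathcomp Require Import all_classical all_reals all_analysis.

Set Implicit Arguments.
Unset Strict Implicit.
Unset Printing Implicit Defensive.

Import Order.TTheory GRing.Theory Num.Theory.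
Import numFieldNormedType.Exports.

Local Open Scope classical_set_scope.
Local Open Scope ring_scope.

(* [O] is meant to be open and [V] finite-dimensional.  Requiring
   differentiability at every order together with [C^k] directional
   derivatives gives the usual notion of a [C^(k+1)] map. *)

Fixpoint Ck_on (R : realType) (V W : normedModType R) (k : nat) (O : set V)
    (f : V -> W) : Prop :=
  match k with
  | 0%N => forall v, O v -> {for v, continuous f}
  | k'.+1 => (forall v, O v -> differentiable f v) /\
             (forall w, Ck_on k' O (fun v => 'D_w f v : W))
  end.

Definition smooth_on (R : realType) (V W : normedModType R) (O : set V)
    (f : V -> W) : Prop :=
  forall k, Ck_on k O f.

Record atlas (R : realType) (V : normedModType R) (X : Type) := Atlas {
  chart : Type;
  dom : chart -> set X;
  crd : chart -> X -> V }.

Section Atlas.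
Variables (R : realType) (V : normedModType R) (X : Type) (A : atlas V X).

Definition img (c : chart A) : set V := crd c @` dom c.

Definition overlap (c c' : chart A) : set V := crd c @` (dom c `&` dom c').

(* The change of coordinates [crd c' \o (crd c)^-1], with the junk value [0]
   outside [overlap c c']. *)
Definition trans (c c' : chart A) (v : V) : V :=
  xget 0 [set w | exists x, [/\ dom c x, dom c' x, crd c x = v & crd c' x = w]].

End Atlas.

Record manifold (R : realType) (d : nat) := Manifold {
  mpoint :> topologicalType;
  matlas : atlas 'rV[R]_d mpoint;
  mfd_hausdorff : hausdorff_space mpoint;
  mfd_second_countable : @second_countable mpoint;
  mfd_cover : forall x : mpoint, exists a : chart matlas, dom a x;
  mfd_dom_open : forall a : chart matlas, open (dom a);
  mfd_crd_inj : forall (a : chart matlas) (x y : mpoint),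
        dom a x -> dom a y -> crd a x = crd a y -> x = y;
  (* [crd a] is a homeomorphism of [dom a] onto an open set *)
  mfd_crd_homeo : forall (a : chart matlas) (B : set mpoint),
        B `<=` dom a -> (open B <-> open (crd a @` B));
  mfd_trans_smooth : forall a a' : chart matlas, smooth_on (overlap a a') (trans a a') }.

(* A vector field on an open set [O] of the image of a chart [c] is given by
   its components [Y : V -> V] in the coordinates [c], used on [O] only.  A
   linear connection is a family of Koszul operators acting on such local
   fields, compatible with restriction and with changes of coordinates. *)

Section Connection.
Variables (R : realType) (V : normedModType R) (X : Type) (A : atlas V X).

(* [Y'] is, in the coordinates [c'], the field [Y] on [O] *)
Definition pushed (c c' : chart A) (O : set V) (Y Y' : V -> V) : Prop :=
  smooth_on (trans c c' @` O) Y' /\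
  forall v, O v -> Y' (trans c c' v) = 'D_(Y v) (trans c c') v.

Record linear_connection := LinearConnection {
  nabla :> chart A -> (V -> V) -> (V -> V) -> V -> V;
  nabla_smooth : forall c (O : set V) (Y Z : V -> V),
    open O -> O `<=` img c -> smooth_on O Y -> smooth_on O Z ->
    smooth_on O (nabla c Y Z);
  nabla_local : forall c (O : set V) (Y Y' Z Z' : V -> V),
    open O -> O `<=` img c -> smooth_on O Y -> smooth_on O Z ->
    {in O, Y =1 Y'} -> {in O, Z =1 Z'} ->
    {in O, nabla c Y Z =1 nabla c Y' Z'};
  nabla_addl : forall c (O : set V) (Y Y' Z : V -> V),
    open O -> O `<=` img c -> smooth_on O Y -> smooth_on O Y' ->
    smooth_on O Z ->
    {in O, nabla c (Y + Y') Z =1 nabla c Y Z + nabla c Y' Z};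
  nabla_scalel : forall c (O : set V) (f : V -> R) (Y Z : V -> V),
    open O -> O `<=` img c -> smooth_on O f -> smooth_on O Y ->
    smooth_on O Z ->
    {in O, nabla c (fun v => f v *: Y v) Z =1 fun v => f v *: nabla c Y Z v};
  nabla_addr : forall c (O : set V) (Y Z Z' : V -> V),
    open O -> O `<=` img c -> smooth_on O Y -> smooth_on O Z ->
    smooth_on O Z' ->
    {in O, nabla c Y (Z + Z') =1 nabla c Y Z + nabla c Y Z'};
  nabla_leibniz : forall c (O : set V) (f : V -> R) (Y Z : V -> V),
    open O -> O `<=` img c -> smooth_on O f -> smooth_on O Y ->
    smooth_on O Z ->
    {in O, nabla c Y (fun v => f v *: Z v) =1
           fun v => 'D_(Y v) f v *: Z v + f v *: nabla c Y Z v};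
  nabla_change : forall c c' (O : set V) (Y Y' Z Z' : V -> V),
    open O -> O `<=` overlap c c' -> smooth_on O Y -> smooth_on O Z ->
    pushed c c' O Y Y' -> pushed c c' O Z Z' ->
    forall v, O v ->
      nabla c' Y' Z' (trans c c' v) = 'D_(nabla c Y Z v) (trans c c') v }.

End Connection.

Section Jets.
Variables (R : realType) (p n : nat) (T : manifold R p) (M : manifold R n).

(* [crd b \o f \o (crd a)^-1]; the point [t] is only a default value for the
   inverse outside [img a]. *)
Definition local_rep (a : chart (matlas T)) (b : chart (matlas M)) (t : T)
    (f : T -> M) : 'rV[R]_p -> 'rV[R]_n :=
  fun v => crd b (f (xget t [set s | dom a s /\ crd a s = v])).

Definition smooth_near (t : T) (f : T -> M) : Prop :=
  exists (a : chart (matlas T)) (b : chart (matlas M)) (O : set 'rV[R]_p),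
    [/\ dom a t, open O /\ O (crd a t), O `<=` img a,
        (forall s : T, dom a s -> O (crd a s) -> dom b (f s))
      & smooth_on O (local_rep a b t f)].

Definition same_jet (t : T) (f f' : T -> M) : Prop :=
  f t = f' t /\
  forall (a : chart (matlas T)) (b : chart (matlas M)),
    dom a t -> dom b (f t) ->
    jacobian (local_rep a b t f) (crd a t) =
    jacobian (local_rep a b t f') (crd a t).

(* A point of [J^1(T, M)]: a source and a 1-jet of smooth maps there, given as
   an equivalence class of maps. *)
Record jet1 := Jet1 {
  jet_src : T;
  jet_class : set (T -> M);
  jet_classP : exists f, smooth_near jet_src f /\
    jet_class = [set f' | smooth_near jet_src f' /\ same_jet jet_src f f'] }.

Definition jet_map (e : jet1) : T -> M := projT1 (cid (jet_classP e)).

(* Coordinates [(t^alpha, x^i, x^i_alpha)]: the entry [(i, alpha)] of the last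
   component is [x^i_alpha]. *)
Definition jcoord : normedModType R :=
  ('rV[R]_p * 'rV[R]_n * 'M[R]_(n, p))%type.

(* The library's [jacobian f v] has [d f^i / d v^alpha] in position
   [(alpha, i)]. *)
Definition jet_atlas : atlas jcoord jet1 := {|
  chart := chart (matlas T) * chart (matlas M);
  dom := fun c e => dom c.1 (jet_src e) /\ dom c.2 (jet_map e (jet_src e));
  crd := fun c e =>
    (crd c.1 (jet_src e), crd c.2 (jet_map e (jet_src e)),
     (jacobian (local_rep c.1 c.2 (jet_src e) (jet_map e))
        (crd c.1 (jet_src e)))^T) |}.

Definition jchart := chart jet_atlas.

(* Jacobian factors of a change of jet coordinates:
   [jacT c c' v alpha beta = d t~^beta / d t^alpha] and
   [jacM c c' v i j = d x~^j / d x^i]. *)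
Definition jacT (c c' : jchart) (v : jcoord) : 'M[R]_p :=
  jacobian (trans c.1 c'.1) v.1.1.
Definition jacM (c c' : jchart) (v : jcoord) : 'M[R]_n :=
  jacobian (trans c.2 c'.2) v.1.2.

End Jets.

Arguments jcoord : clear implicits.

(* Congruence to [diag(-1, .., -1, 1, .., 1)] with [q] entries [-1]. *)
Definition has_index (R : realType) (m : nat) (S : 'M[R]_m) (q : nat) : Prop :=
  exists2 P : 'M[R]_m, P \in unitmx &
    P *m S *m P^T = diag_mx (\row_i (if (i < q)%N then -1 else 1)).

Record semiRiemannian (R : realType) (p : nat) (T : manifold R p) :=
  SemiRiemannian {
  hmx :> chart (matlas T) -> 'rV[R]_p -> 'M[R]_p;
  hmx_smooth : forall a al be, smooth_on (img a) (fun t => hmx a t al be);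
  hmx_sym : forall a t, img a t -> (hmx a t)^T = hmx a t;
  hmx_unit : forall a t, img a t -> hmx a t \in unitmx;
  hmx_index : exists q, forall a t, img a t -> has_index (hmx a t) q;
  hmx_tensor : forall a a' t, overlap a a' t ->
    hmx a t = jacobian (trans a a') t *m hmx a' (trans a a' t)
                *m (jacobian (trans a a') t)^T }.

(* [christoffel h a t ga al be] is [H^ga_(al be)] *)
Definition christoffel (R : realType) (p : nat) (T : manifold R p)
    (h : semiRiemannian T) (a : chart (matlas T)) (t : 'rV[R]_p)
    (ga al be : 'I_p) : R :=
  \sum_(et < p) invmx (h a t) ga et / 2%:R *
    ('D_(delta_mx 0 al) (fun s => h a s et be) t +
     'D_(delta_mx 0 be) (fun s => h a s et al) t -
     'D_(delta_mx 0 et) (fun s => h a s al be) t).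

Record gml_space (R : realType) (p n : nat) (T : manifold R p)
    (M : manifold R n) := GMLSpace {
  gml_h : semiRiemannian T;
  gml_g : jchart T M -> jcoord R p n -> 'M[R]_n;
  gml_smooth : forall c i j, smooth_on (img c) (fun v => gml_g c v i j);
  gml_sym : forall c v, img c v -> (gml_g c v)^T = gml_g c v;
  gml_rank : forall c v, img c v -> \rank (gml_g c v) = n;
  gml_index : exists q, forall c v, img c v -> has_index (gml_g c v) q;
  gml_tensor : forall c c' v, overlap c c' v ->
    gml_g c v = jacM c c' v *m gml_g c' (trans c c' v) *m (jacM c c' v)^T;
  (* the vertical metrical d-tensor [G^(al)(be)_(i)(j)] *)
  gml_G : jchart T M -> jcoord R p n -> 'I_p -> 'I_p -> 'I_n -> 'I_n -> R;
  gml_GE : forall c v, img c v -> forall al be i j,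
    gml_G c v al be i j = invmx (gml_h c.1 v.1.1) al be * gml_g c v i j }.

Section Adapted.
Variables (R : realType) (p n : nat).

Notation V := (jcoord R p n).

Definition e_t (al : 'I_p) : V := (delta_mx 0 al, 0, 0).
Definition e_x (i : 'I_n) : V := (0, delta_mx 0 i, 0).

(* [d / d x^i_al] *)
Definition dv (i : 'I_n) (al : 'I_p) : V := (0, 0, delta_mx i al).

(* [delta / delta t^al], where [Mv j be al] is [M^(j)_(be)al] *)
Definition dt_of (Mv : 'I_n -> 'I_p -> 'I_p -> R) (al : 'I_p) : V :=
  e_t al - \sum_(j < n) \sum_(be < p) Mv j be al *: dv j be.

(* [delta / delta x^i], where [Nv j be i] is [N^(j)_(be)i] *)
Definition dx_of (Nv : 'I_n -> 'I_p -> 'I_n -> R) (i : 'I_n) : V :=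
  e_x i - \sum_(j < n) \sum_(be < p) Nv j be i *: dv j be.

End Adapted.

Arguments dv {R p n} i al.

Record nonlinear_connection (R : realType) (p n : nat) (T : manifold R p)
    (M : manifold R n) := NonlinearConnection {
  nlM : jchart T M -> jcoord R p n -> 'I_n -> 'I_p -> 'I_p -> R;
  nlN : jchart T M -> jcoord R p n -> 'I_n -> 'I_p -> 'I_n -> R;
  nlM_smooth : forall c i al be, smooth_on (img c) (fun v => nlM c v i al be);
  nlN_smooth : forall c i al j, smooth_on (img c) (fun v => nlN c v i al j);
  nl_dt_tensor : forall c c' v, overlap c c' v -> forall al : 'I_p,
    'D_(dt_of (nlM c v) al) (trans c c') v =
    \sum_(be < p) jacT c c' v al be *: dt_of (nlM c' (trans c c' v)) be;
  nl_dx_tensor : forall c c' v, overlap c c' v -> forall i : 'I_n,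
    'D_(dx_of (nlN c v) i) (trans c c') v =
    \sum_(j < n) jacM c c' v i j *: dx_of (nlN c' (trans c c' v)) j }.

Section HNormal.
Variables (R : realType) (p n : nat) (T : manifold R p) (M : manifold R n).
Variables (h : semiRiemannian T) (Gam : nonlinear_connection T M).

Notation V := (jcoord R p n).

Definition dt (c : jchart T M) (al : 'I_p) (v : V) : V :=
  dt_of (nlM Gam c v) al.
Definition dx (c : jchart T M) (i : 'I_n) (v : V) : V :=
  dx_of (nlN Gam c v) i.
Definition dy (i : 'I_n) (al : 'I_p) (v : V) : V := dv i al.

(* [cG c v k j ga] is [G^k_(j ga)], [cL c v i j k] is [L^i_(jk)] and
   [cC c v i j k ga] is [C^(i(ga))_(j(k))]. *)
Record hnormal_connection := HNormal {
  hn_nabla :> linear_connection (jet_atlas T M);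
  cG : jchart T M -> V -> 'I_n -> 'I_n -> 'I_p -> R;
  cL : jchart T M -> V -> 'I_n -> 'I_n -> 'I_n -> R;
  cC : jchart T M -> V -> 'I_n -> 'I_n -> 'I_n -> 'I_p -> R;
  hn_tt : forall c v, img c v -> forall ga al,
    hn_nabla c (dt c ga) (dt c al) v =
    \sum_(be < p) christoffel h c.1 v.1.1 be al ga *: dt c be v;
  hn_xt : forall c v, img c v -> forall k al,
    hn_nabla c (dx c k) (dt c al) v = 0;
  hn_yt : forall c v, img c v -> forall k ga al,
    hn_nabla c (dy k ga) (dt c al) v = 0;
  hn_tx : forall c v, img c v -> forall ga j,
    hn_nabla c (dt c ga) (dx c j) v = \sum_(k < n) cG c v k j ga *: dx c k v;
  hn_xx : forall c v, img c v -> forall k j,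
    hn_nabla c (dx c k) (dx c j) v = \sum_(i < n) cL c v i j k *: dx c i v;
  hn_yx : forall c v, img c v -> forall k ga j,
    hn_nabla c (dy k ga) (dx c j) v =
    \sum_(i < n) cC c v i j k ga *: dx c i v;
  hn_ty : forall c v, img c v -> forall ga i al,
    hn_nabla c (dt c ga) (dy i al) v =
    \sum_(k < n) cG c v k i ga *: dy k al v -
    \sum_(et < p) christoffel h c.1 v.1.1 al et ga *: dy i et v;
  hn_xy : forall c v, img c v -> forall k i al,
    hn_nabla c (dx c k) (dy i al) v =
    \sum_(l < n) cL c v l i k *: dy l al v;
  hn_yy : forall c v, img c v -> forall k ga i al,
    hn_nabla c (dy k ga) (dy i al) v =
    \sum_(l < n) cC c v l i k ga *: dy l al v }.

(* Equality of connections: coefficients are compared on the coordinate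
   domains, the operators on smooth local vector fields. *)
Definition hn_eq (D D' : hnormal_connection) : Prop :=
  [/\ forall c v, img c v -> forall k j ga, cG D c v k j ga = cG D' c v k j ga,
      forall c v, img c v -> forall i j k, cL D c v i j k = cL D' c v i j k,
      forall c v, img c v -> forall i j k ga,
        cC D c v i j k ga = cC D' c v i j k ga
    & forall c (O : set V) (Y Z : V -> V),
        open O -> O `<=` img c -> smooth_on O Y -> smooth_on O Z ->
        {in O, D c Y Z =1 D' c Y Z}].

Variable g : jchart T M -> V -> 'M[R]_n.

(* [g_(ij|k)] *)
Definition hcov (D : hnormal_connection) (c : jchart T M) (v : V)
    (i j k : 'I_n) : R :=
  'D_(dx c k v) (fun w => g c w i j) v
  - \sum_(m < n) cL D c v m i k * g c v m j
  - \sum_(m < n) cL D c v m j k * g c v i m.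

(* [g_ij|^(ga)_(k)] *)
Definition vcov (D : hnormal_connection) (c : jchart T M) (v : V)
    (i j k : 'I_n) (ga : 'I_p) : R :=
  'D_(dy k ga v) (fun w => g c w i j) v
  - \sum_(m < n) cC D c v m i k ga * g c v m j
  - \sum_(m < n) cC D c v m j k ga * g c v i m.

Definition g_metrical (D : hnormal_connection) : Prop :=
  (forall c v, img c v -> forall i j k, hcov D c v i j k = 0) /\
  (forall c v, img c v -> forall i j k ga, vcov D c v i j k ga = 0).

Definition cartan_conditions (D : hnormal_connection) : Prop :=
  [/\ forall c v, img c v -> forall k j ga,
        cG D c v k j ga =
        \sum_(i < n) invmx (g c v) k i / 2%:R *
          'D_(dt c ga v) (fun w => g c w i j) v,
      forall c v, img c v -> forall k i j, cL D c v k i j = cL D c v k j i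
    & forall c v, img c v -> forall i j k ga,
        cC D c v i j k ga = cC D c v i k j ga].

End HNormal.

(* Main.v *)
Require Import Defs.
From HB Require Import structures.
From mathcomp Require Import all_boot all_order all_algebra.
From mathcomp Require Import all_classical all_reals all_analysis.
From mathcomp Require Import ring.
Import Order.TTheory GRing.Theory Num.Theory.
Import numFieldNormedType.Exports.
Set Implicit Arguments.
Unset Strict Implicit.
Unset Printing Implicit Defensive.
Local Open Scope classical_set_scope.
Local Open Scope ring_scope.

(** In the adapted frame of [Gam] an h-normal connection is given by two matrices
    of 1-forms: [time_form], with coefficients the Christoffel symbols of [h], and
    [metric_form], with coefficients G, L and C.  For L and for each [C^(ga)] the
    conditions i) and ii) say that [metric_form] is metrical and symmetric, so the
    Koszul computation determines it.  Its behaviour under a change of charts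
    follows from this uniqueness: the transported form
    [(dK + K Theta') K^-1] is again metrical, and it is symmetric because the
    second derivatives of [x~(x)] commute.  The Koszul operator is then
    [D_Y Z + omega(Y, Z)] on frame components.

    Equalities such as [g^T = g] hold on [img c] only, so differentiating them
    requires [img c] to be open in the jet coordinates, that is, every value of
    [(t, x, x_al)] over a chart has to be realised by a smooth map near [t]. *)

(** * The Koszul formula *)

(** Connection matrices act from the right on rows of components: the row is the lower index and the
    column the upper one, so L^i_(jk) is the entry (j, i) of the k-th matrix. This agrees with the
    convention of [jacobian], and the change law reads Theta K = dK + K Theta'.

    For G nothing has to be solved: ii) prescribes it, and its factor 1/2 makes it metrical along
    delta/delta t^ga too, since dg is symmetric. The laws of G and C contain no dK, because K =
    dx~/dx depends on x alone; only H and L meet second derivatives of a change of coordinates.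

    Uniqueness of the coefficients is linear algebra at each point. The weight lies on existence: a
    [linear_connection] must be smooth to every order and agree across all jet charts. In coordinate
    components the differential of a jet transition has off-diagonal terms, second derivatives
    contracted with x^i_al. In adapted components it is block diagonal, with blocks given by J, K
    and y |-> K^T y J^-T, so that only the derivatives of these factors have to be matched with the
    inhomogeneous terms of the two forms. *)

Section Koszul.
Context {R : numFieldType} {n : nat}.
Implicit Types (g K : 'M[R]_n) (dg dK : 'I_n -> 'M[R]_n).

Definition koszul g dg (i j k : 'I_n) : R :=
  \sum_m invmx g i m / 2%:R * (dg k m j + dg j m k - dg m j k).

Definition koszul_mx g dg (k : 'I_n) : 'M[R]_n :=
  \matrix_(j, i) koszul g dg i j k.

Lemma koszul_sym g dg i j k :
  (forall l, (dg l)^T = dg l) -> koszul g dg i j k = koszul g dg i k j.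
Proof.
move=> dgT; apply: eq_bigr => m _; congr (_ * (_ - _)); first by rewrite addrC.
by rewrite -[in LHS](dgT m) mxE.
Qed.

(** Lowering the upper index cancels [invmx g] and leaves the Christoffel symbols of the first kind,
    in which the metric condition and uniqueness become identities between entries of [dg]. *)
Lemma koszul_lower g dg j k l : g \in unitmx -> g^T = g ->
  (koszul_mx g dg k *m g) j l = (dg k l j + dg j l k - dg l j k) / 2%:R.
Proof.
move=> ug gT; rewrite mxE.
transitivity (\sum_m (g *m invmx g) l m *
    ((dg k m j + dg j m k - dg m j k) / 2%:R)); last first.
  rewrite (bigD1 l)//= mulmxV// mxE eqxx mul1r big1 ?addr0// => m /negbTE ml.
  by rewrite mxE eq_sym ml mul0r.
under eq_bigr do rewrite mxE mulr_suml.
rewrite exchange_big; apply: eq_bigr => m _.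
rewrite mxE mulr_suml; apply: eq_bigr => i _.
have -> : g i l = g l i by rewrite -[in LHS]gT mxE.
ring.
Qed.

Lemma koszul_metric g dg k : g \in unitmx -> g^T = g ->
    (forall l, (dg l)^T = dg l) ->
  dg k = koszul_mx g dg k *m g + (koszul_mx g dg k *m g)^T.
Proof.
move=> ug gT dgT; apply/matrixP => i j; rewrite mxE [X in _ + X]mxE !koszul_lower//.
have dgC l a b : dg l a b = dg l b a by rewrite -[in LHS]dgT mxE.
by rewrite (dgC k j i) (dgC j i k) (dgC i j k); field.
Qed.

(** The classical permutation argument. Once lowered, [T] is symmetric in its first two slots;
    replacing each [dg] in the first-kind symbol by two lowered entries of [T] gives six terms, four
    of which cancel while the other two coincide. *)
Lemma koszul_unique g dg (T : 'I_n -> 'M[R]_n) : g \in unitmx -> g^T = g ->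
    (forall k j i, T k j i = T j k i) ->
    (forall k, dg k = T k *m g + (T k *m g)^T) ->
  forall k, T k = koszul_mx g dg k.
Proof.
move=> ug gT Tsym dgE k; rewrite -[LHS](mulmxK ug) -[RHS](mulmxK ug).
congr (_ *m _); apply/matrixP => j l; rewrite koszul_lower//.
have Tlow a b c : (T a *m g) b c = (T b *m g) a c.
  by rewrite !mxE; apply: eq_bigr => m _; rewrite Tsym.
have dgl a b c : dg a b c = (T a *m g) b c + (T a *m g) c b.
  by rewrite dgE mxE [X in _ + X]mxE.
rewrite !dgl (Tlow j l k) (Tlow j k l) (Tlow l k j) (Tlow k l j) (Tlow l j k).
by field.
Qed.

(* The right-hand side is the connection of [g'] transported by [K]; it is
   symmetric and metrical for [g], hence equal to the one on the left. *)
Lemma koszul_change g g' dg dg' K dK :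
    g' \in unitmx -> g'^T = g' -> (forall l, (dg' l)^T = dg' l) ->
    K \in unitmx -> g = K *m g' *m K^T ->
    (forall k j i, dK k j i = dK j k i) ->
    (forall k, dg k = dK k *m g' *m K^T
       + K *m (\sum_l K k l *: dg' l) *m K^T + K *m g' *m (dK k)^T) ->
  forall k, koszul_mx g dg k *m K =
    dK k + K *m (\sum_l K k l *: koszul_mx g' dg' l).
Proof.
move=> ug' g'T dg'T uK gE dKsym dgE k.
have uKT : K^T \in unitmx by rewrite unitmx_tr.
have ug : g \in unitmx by rewrite gE !unitmx_mul uK ug' uKT.
have gT : g^T = g by rewrite gE !trmx_mul trmxK g'T mulmxA.
pose N l := dK l + K *m (\sum_m K l m *: koszul_mx g' dg' m).
pose T l := N l *m invmx K.
rewrite -(@koszul_unique g dg T)//; first by rewrite /T mulmxKV.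
(* Symmetry: [invmx K] touches the upper index only, [dK] is symmetric by hypothesis, and in K_k^a
   K_j^b Gamma'_(ab) exchanging k and j amounts to exchanging a and b. *)
- move=> {}k j i; rewrite !mxE; apply: eq_bigr => l _; congr (_ * _).
  rewrite mxE [in RHS]mxE dKsym; congr (_ + _); rewrite !mxE.
  under eq_bigr do rewrite summxE mulr_sumr.
  under [in RHS]eq_bigr do rewrite summxE mulr_sumr.
  rewrite exchange_big; apply: eq_bigr => a _; apply: eq_bigr => b _.
  by rewrite !mxE koszul_sym//; ring.
(* Metricity: [T k *m g] equals [N k *m g' *m K^T], and the parts of [N] other than [dK] recombine
   with their transposes into the derivative of [g'], by [koszul_metric] for [g']. *)
- move=> {}k.
  have TgE : T k *m g = N k *m g' *m K^T by rewrite gE !mulmxA /T mulmxKV.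
  rewrite TgE dgE /N !mulmxDl linearD /= !trmx_mul trmxK g'T.
  rewrite -!mulmxA !addrA addrAC.
  congr (_ + _); rewrite -addrA; congr (_ + _).
  set B := \sum_(m < n) K k m *: koszul_mx _ _ m.
  suff -> : \sum_(l < n) K k l *: dg' l = B *m g' + g' *m B^T.
    by rewrite mulmxDl mulmxDr !mulmxA.
  rewrite /B mulmx_suml linear_sum /= mulmx_sumr -big_split; apply: eq_bigr => l _.
  rewrite [in LHS](koszul_metric l ug' g'T dg'T) trmx_mul g'T scalerDr.
  by rewrite linearZ /= -scalemxAl -scalemxAr.
Qed.

End Koszul.

(** * Differential calculus *)

Section Differentiation.
Context {R : realType}.
Implicit Types U V W : normedModType R.

Lemma is_diff_derive V W (f df : V -> W) (v w : V) :
  is_diff v f df -> 'D_w f v = df w.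
Proof. by move=> fdf; rewrite deriveE ?diff_val//; case: fdf. Qed.

(** The first order expansion of [f] at [v] involves only values near [v], so it is also one for
    [g]; [diff_unique] then identifies the differential of [g]. *)
Lemma is_diff_near V W (f g df : V -> W) (v : V) :
  (\near v, f v = g v) -> is_diff v f df -> is_diff v g df.
Proof.
move=> fg [/diff_locallyP[cdf fE] <-].
have gE : g \o shift v = cst (g v) + 'd f v +o_0 id.
  apply/eqaddoP => e e0.
  have := (eqaddoP _ _ _ _).1 fE e e0.
  have fgv : f v = g v by exact: nbhs_singleton fg.
  have shv : h + v @[h --> (0 : V)] --> v.
    by rewrite -[X in _ --> X]add0r; apply: cvgD; [exact: cvg_id|exact: cvg_cst].
  have fg0 : \forall h \near (0 : V), f (h + v) = g (h + v) by exact: shv fg.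
  by apply: filterS2 fg0 => h /= fgh; rewrite /= !fctE fgv fgh.
have dE := diff_unique cdf gE.
apply: DiffDef; last exact: dE.
apply/diff_locallyP; split; first by rewrite [X in continuous X]dE.
by rewrite [X in cst _ + X]dE.
Qed.

Lemma is_diff_lin V W (L : {linear V -> W}) (v : V) :
  continuous L -> is_diff v L L.
Proof.
move=> cL; apply: DiffDef; first exact: linear_differentiable.
exact: diff_lin.
Qed.

Lemma fst_continuous V W : continuous (fun x : V * W => x.1).
Proof. by move=> x; exact: cvg_fst. Qed.

Lemma snd_continuous V W : continuous (fun x : V * W => x.2).
Proof. by move=> x; exact: cvg_snd. Qed.

Lemma scale_is_bilinear W :
  bilinear_for (GRing.Scale.Law.clone _ _ *:%R _)
    (GRing.Scale.Law.clone _ _ *:%R _) (@GRing.scale R W).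
Proof.
split=> [u'|u] a x y /=.
- by rewrite scalerDl scalerA.
- by rewrite scalerDr !scalerA mulrC.
Qed.

(** Scaling is a continuous bilinear map, and the claim is the chain rule for it after the pair of
    [f] and [F]. The product rules for scalars and matrices reduce to this case. *)
Lemma is_diff_scale V W (f df : V -> R) (F dF : V -> W) (v : V) :
  is_diff v f df -> is_diff v F dF ->
  is_diff v (fun x => f x *: F x) (fun w => df w *: F v + f v *: dF w).
Proof.
move=> fdf FdF.
pose bM := bilinear_isBilinear.Build R R W W _ _ (@GRing.scale R W)
  (@scale_is_bilinear W).
pose b : {bilinear R -> W -> W} := HB.pack (@GRing.scale R W) bM.
have bc : continuous (fun p : R * W => b p.1 p.2).
  by move=> p; exact: scale_continuous.
have bdiff : is_diff (f v, F v) (fun p : R * W => b p.1 p.2)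
    (fun q => f v *: q.2 + q.1 *: F v).
  apply: DiffDef; first exact: differentiable_bilin.
  exact: (@diff_bilin _ _ _ _ b (f v, F v) bc).
have H := is_diff_comp (is_diff_pair fdf FdF) bdiff.
by apply: (is_diff_eq H); apply/funext => w /=; rewrite addrC.
Qed.

Lemma differentiable_is_diff V W (f : V -> W) (v : V) :
  differentiable f v -> is_diff v f (fun w => 'D_w f v).
Proof. by move=> df; apply: DiffDef => //; apply/funext => w; rewrite deriveE. Qed.

Lemma is_diff_differentiable V W (f df : V -> W) (v : V) :
  is_diff v f df -> differentiable f v.
Proof. by case. Qed.

Lemma is_diff_linl V W W' (L : {linear W -> W'}) (f df : V -> W) (v : V) :
  continuous L -> is_diff v f df ->
  is_diff v (fun x => L (f x)) (fun w => L (df w)).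
Proof. by move=> /(is_diff_lin (f v)) dL fdf; exact: is_diff_comp fdf dL. Qed.

Lemma is_diff_fst V W W' (f df : V -> W * W') (v : V) :
  is_diff v f df -> is_diff v (fun x => (f x).1) (fun w => (df w).1).
Proof. exact: (is_diff_linl (L := fst) (@fst_continuous W W')). Qed.

Lemma is_diff_snd V W W' (f df : V -> W * W') (v : V) :
  is_diff v f df -> is_diff v (fun x => (f x).2) (fun w => (df w).2).
Proof. exact: (is_diff_linl (L := snd) (@snd_continuous W W')). Qed.

Lemma is_diff_coord V m n (F dF : V -> 'M[R]_(m, n)) (v : V) i j :
  is_diff v F dF -> is_diff v (fun x => F x i j) (fun w => dF w i j).
Proof.
pose L (A : 'M[R]_(m, n)) := A i j.
have lL : linear L by move=> a A B; rewrite /L !mxE.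
pose LL : {linear 'M[R]_(m, n) -> R} :=
  HB.pack L (GRing.isLinear.Build _ _ _ _ L lL).
exact: (is_diff_linl (L := LL) (@coord_continuous R m n i j)).
Qed.

Lemma is_diff_sum V W (I : Type) (r : seq I) (P : pred I) (F dF : I -> V -> W) v :
  (forall i, P i -> is_diff v (F i) (dF i)) ->
  is_diff v (fun x => \sum_(i <- r | P i) F i x)
            (fun w => \sum_(i <- r | P i) dF i w).
Proof.
move=> FdF; elim: r => [|i r IHr].
  rewrite (_ : (fun x => _) = cst 0); last by apply/funext => x; rewrite big_nil.
  apply: (is_diff_eq (is_diff_cst _ _)).
  by apply/funext => x; rewrite big_nil.
case Pi : (P i); last first.
  rewrite (_ : (fun x => _) = fun x => \sum_(i <- r | P i) F i x); last first.
    by apply/funext => x; rewrite big_cons Pi.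
  by apply: (is_diff_eq IHr); apply/funext => w; rewrite big_cons Pi.
rewrite (_ : (fun x => _) = F i + fun x => \sum_(i <- r | P i) F i x); last first.
  by apply/funext => x; rewrite big_cons Pi.
apply: (is_diff_eq (is_diffD (FdF _ Pi) IHr)).
by apply/funext => w; rewrite big_cons Pi.
Qed.

Lemma is_diff_add V W (f df g dg : V -> W) (v : V) :
  is_diff v f df -> is_diff v g dg ->
  is_diff v (fun x => f x + g x) (fun w => df w + dg w).
Proof. by move=> fdf gdg; exact: is_diffD. Qed.

Lemma is_diff_mx V m n (F dF : V -> 'M[R]_(m, n)) (v : V) :
  (forall i j, is_diff v (fun x => F x i j) (fun w => dF w i j)) ->
  is_diff v F dF.
Proof.
move=> FdF.
rewrite (_ : F = fun x => \sum_i \sum_j F x i j *: delta_mx i j); last first.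
  by apply/funext => x; exact: matrix_sum_delta.
have H : forall i j, is_diff v (fun x => F x i j *: delta_mx i j : 'M[R]_(m, n))
    (fun w => dF w i j *: delta_mx i j).
  move=> i j; apply: (is_diff_eq (is_diff_scale (FdF i j) (is_diff_cst _ _))).
  by apply/funext => w /=; rewrite scaler0 addr0.
apply: is_diff_eq.
  by apply: is_diff_sum => i _; apply: is_diff_sum => j _; exact: H.
by apply/funext => w; rewrite -matrix_sum_delta.
Qed.

Lemma is_diff_mul V (f df g dg : V -> R) (v : V) :
  is_diff v f df -> is_diff v g dg ->
  is_diff v (fun x => f x * g x) (fun w => df w * g v + f v * dg w).
Proof. exact: is_diff_scale. Qed.

Lemma is_diff_mulmx V m n k (F dF : V -> 'M[R]_(m, n)) (G dG : V -> 'M[R]_(n, k))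
    (v : V) : is_diff v F dF -> is_diff v G dG ->
  is_diff v (fun x => F x *m G x) (fun w => dF w *m G v + F v *m dG w).
Proof.
move=> FdF GdG; apply: is_diff_mx => i j.
rewrite (_ : (fun x => _) = fun x => \sum_l F x i l * G x l j); last first.
  by apply/funext => x; rewrite mxE.
have H l := is_diff_mul (is_diff_coord i l FdF) (is_diff_coord l j GdG).
apply: is_diff_eq; first by apply: is_diff_sum => l _; exact: H.
by apply/funext => w; rewrite !mxE -big_split.
Qed.

Lemma is_diff_trmx V m n (F dF : V -> 'M[R]_(m, n)) (v : V) :
  is_diff v F dF -> is_diff v (fun x => (F x)^T) (fun w => (dF w)^T).
Proof.
move=> FdF; apply: is_diff_mx => i j.
rewrite (_ : (fun x => _) = fun x => F x j i); last first.
  by apply/funext => x; rewrite mxE.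
by apply: (is_diff_eq (is_diff_coord j i FdF)); apply/funext => w; rewrite mxE.
Qed.

Lemma derive_sum V W (f : V -> W) (v : V) (I : Type) (r : seq I) (P : pred I)
    (E : I -> V) : differentiable f v ->
  'D_(\sum_(i <- r | P i) E i) f v = \sum_(i <- r | P i) 'D_(E i) f v.
Proof.
by move=> df; rewrite deriveE// linear_sum; apply: eq_bigr => i _; rewrite deriveE.
Qed.

Lemma derive_comp V W W' (f : V -> W) (g : W -> W') (v w : V) :
  differentiable f v -> differentiable g (f v) ->
  'D_w (g \o f) v = 'D_('D_w f v) g (f v).
Proof.
move=> /differentiable_is_diff df /differentiable_is_diff dg.
by rewrite (is_diff_derive w (is_diff_comp df dg)).
Qed.

End Differentiation.

(** * Smooth maps *)

Section Smooth.
Context {R : realType}.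
Implicit Types V W : normedModType R.

(** On an open set equality at the points of [O] is equality near each of them, so the directional
    derivatives also agree on [O] and the induction goes on. *)
Lemma Ck_on_eq V W k (O : set V) (f g : V -> W) :
  open O -> (forall v, O v -> f v = g v) -> Ck_on k O f -> Ck_on k O g.
Proof.
move=> oO; elim: k f g => [|k IHk] f g fg /=.
  move=> fc v Ov.
  have nfg : {near v, f =1 g}.
    by apply: filterS (open_nbhs_nbhs (conj oO Ov)) => x; exact: fg.
  rewrite /prop_for /continuous_at -(fg v Ov).
  exact: cvg_trans (near_eq_cvg nfg) (fc v Ov).
have nfg v : O v -> \forall x \near v, f x = g x.
  by move=> Ov; apply: filterS (open_nbhs_nbhs (conj oO Ov)) => x; exact: fg.
move=> [fd fC]; split=> [v Ov|w].
  have := is_diff_near (nfg v Ov) (differentiable_is_diff (fd v Ov)).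
  exact: is_diff_differentiable.
by apply: IHk (fC w) => v Ov; apply: near_eq_derive; exact: nfg.
Qed.

Lemma Ck_on_sub V W k (O O' : set V) (f : V -> W) :
  O' `<=` O -> Ck_on k O f -> Ck_on k O' f.
Proof.
move=> O'O; elim: k f => [|k IHk] f /=; first by move=> fc v /O'O; exact: fc.
by move=> [fd fC]; split=> [v /O'O|w]; [exact: fd|exact/IHk/fC].
Qed.

Lemma Ck_onW V W k (O : set V) (f : V -> W) : Ck_on k.+1 O f -> Ck_on k O f.
Proof.
elim: k f => [|k IHk] f [fd fC].
  by move=> v /fd; exact: differentiable_continuous.
by split=> // w; apply: IHk; exact: fC.
Qed.

Lemma Ck_on_cst V W k (O : set V) (a : W) : Ck_on k O (fun=> a).
Proof.
elim: k a => [|k IHk] a /=; first by move=> v _; exact: cvg_cst.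
split=> // w.
rewrite [X in Ck_on _ _ X](_ : _ = fun=> 0); first exact: IHk.
by apply/funext => v; exact: derive_cst.
Qed.

Lemma Ck_onD V W k (O : set V) (f g : V -> W) :
  open O -> Ck_on k O f -> Ck_on k O g -> Ck_on k O (fun v => f v + g v).
Proof.
move=> oO; elim: k f g => [|k IHk] f g /=.
  by move=> fc gc v Ov; apply: cvgD; [exact: fc|exact: gc].
move=> [fd fC] [gd gC]; split=> [v Ov|w].
  by apply: differentiableD; [exact: fd|exact: gd].
apply: Ck_on_eq (IHk _ _ (fC w) (gC w)) => // v Ov.
by rewrite deriveD//; apply: diff_derivable; [exact: fd|exact: gd].
Qed.

Lemma Ck_on_lin V W W' k (O : set V) (L : {linear W -> W'}) (f : V -> W) :
  continuous L -> open O -> Ck_on k O f -> Ck_on k O (fun v => L (f v)).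
Proof.
move=> cL oO; elim: k f => [|k IHk] f /=.
  by move=> fc v Ov; apply: continuous_comp; [exact: fc|exact: cL].
move=> [fd fC].
have Lf v : O v -> is_diff v (fun x => L (f x)) (fun w => L ('D_w f v)).
  by move=> Ov; apply/is_diff_linl => //; exact/differentiable_is_diff/fd.
split=> [v /Lf|w]; first exact: is_diff_differentiable.
by apply: Ck_on_eq (IHk _ (fC w)) => // v /Lf/is_diff_derive.
Qed.

Lemma Ck_onZ V W k (O : set V) (f : V -> R) (F : V -> W) :
  open O -> Ck_on k O f -> Ck_on k O F -> Ck_on k O (fun v => f v *: F v).
Proof.
move=> oO; elim: k f F => [|k IHk] f F.
  by move=> fc Fc v Ov; apply: cvgZ; [exact: fc|exact: Fc].
move=> fk Fk; have [fd fC] := fk; have [Fd FC] := Fk.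
have fF v : O v -> is_diff v (fun x => f x *: F x)
    (fun w => 'D_w f v *: F v + f v *: 'D_w F v).
  by move=> Ov; apply: is_diff_scale; apply: differentiable_is_diff;
    [exact: fd|exact: Fd].
split=> [v /fF|w]; first exact: is_diff_differentiable.
(* In each term of the product rule one factor is left undifferentiated; [Ck_onW] lowers it to order
   [k], where the induction hypothesis, uniform in both factors, applies. *)
have C1 := IHk _ _ (fC w) (Ck_onW Fk).
have C2 := IHk _ _ (Ck_onW fk) (FC w).
by apply: Ck_on_eq (Ck_onD oO C1 C2) => // v /fF/is_diff_derive.
Qed.

Lemma Ck_onV V k (O : set V) (f : V -> R) :
  open O -> (forall v, O v -> f v != 0) -> Ck_on k O f ->
  Ck_on k O (fun v => (f v)^-1).
Proof.
move=> oO f0; elim: k => [|k IHk].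
  by move=> fc v Ov; apply: cvgV; [exact: f0|exact: fc].
move=> fk; have [fd fC] := fk.
split=> [v Ov|w]; first by apply: differentiableV; [exact: fd|exact: f0].
(* The derivative of 1/f is -(1/f)^2 Df, so the induction needs 1/f itself at order [k], which is
   its own hypothesis. *)
have fVk := IHk (Ck_onW fk).
have C1 := Ck_onZ oO (Ck_onZ oO fVk fVk) (fC w).
have C2 := Ck_onZ oO (Ck_on_cst k O (-1 : R)) C1.
apply: Ck_on_eq C2 => // v Ov; rewrite deriveV; last exact/diff_derivable/fd.
  by rewrite scaleN1r -scaleNr -exprVn expr2.
exact: f0.
Qed.

(** Composition with a linear map keeps directions constant: the derivative along [w] is the
    derivative of [f] along [L w], composed with [L]. The statement serves to read functions of t
    alone, such as the Christoffel symbols of [h], on jet coordinates. *)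
Lemma Ck_on_comp_lin V V' W k (O : set V') (O' : set V) (L : {linear V -> V'})
    (f : V' -> W) : continuous L -> open O' -> (forall v, O' v -> O (L v)) ->
  Ck_on k O f -> Ck_on k O' (fun v => f (L v)).
Proof.
move=> cL oO' LO; elim: k f => [|k IHk] f.
  by move=> fc v /LO Ov; apply: continuous_comp; [exact: cL|exact: fc].
move=> [fd fC].
have fL v : O' v -> is_diff v (fun x => f (L x)) (fun w => 'D_(L w) f (L v)).
  move=> /LO/fd/differentiable_is_diff fLv.
  exact: (is_diff_comp (is_diff_lin v cL) fLv).
split=> [v /fL|w]; first exact: is_diff_differentiable.
by apply: Ck_on_eq (IHk _ (fC (L w))) => // v /fL/is_diff_derive.
Qed.

Lemma Ck_on_id V k (O : set V) : Ck_on k O (fun v : V => v).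
Proof.
case: k => [|k]; first by move=> v _; exact: cvg_id.
split=> [v _|w]; first by case: (is_diff_id v).
rewrite [X in Ck_on _ _ X](_ : _ = fun=> w); first exact: Ck_on_cst.
by apply/funext => v; exact: derive_id.
Qed.

Lemma smooth_on_eq V W (O : set V) (f g : V -> W) :
  open O -> (forall v, O v -> f v = g v) -> smooth_on O f -> smooth_on O g.
Proof. by move=> oO fg fs k; exact: Ck_on_eq (fs k). Qed.

Lemma smooth_on_sub V W (O O' : set V) (f : V -> W) :
  O' `<=` O -> smooth_on O f -> smooth_on O' f.
Proof. by move=> OO' fs k; exact: Ck_on_sub (fs k). Qed.

Lemma smooth_on_cst V W (O : set V) (a : W) : smooth_on O (fun=> a).
Proof. by move=> k; exact: Ck_on_cst. Qed.

Lemma smooth_on_id V (O : set V) : smooth_on O (fun v : V => v).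
Proof. by move=> k; exact: Ck_on_id. Qed.

Lemma smooth_onD V W (O : set V) (f g : V -> W) :
  open O -> smooth_on O f -> smooth_on O g -> smooth_on O (fun v => f v + g v).
Proof. by move=> oO fs gs k; exact: Ck_onD. Qed.

Lemma smooth_onZ V W (O : set V) (f : V -> R) (F : V -> W) :
  open O -> smooth_on O f -> smooth_on O F -> smooth_on O (fun v => f v *: F v).
Proof. by move=> oO fs Fs k; exact: Ck_onZ. Qed.

Lemma smooth_onM V (O : set V) (f g : V -> R) :
  open O -> smooth_on O f -> smooth_on O g -> smooth_on O (fun v => f v * g v).
Proof. exact: smooth_onZ. Qed.

Lemma smooth_onN V W (O : set V) (f : V -> W) :
  open O -> smooth_on O f -> smooth_on O (fun v => - f v).
Proof.
move=> oO fs; rewrite (_ : (fun v => _) = fun v => (-1) *: f v).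
  by apply: smooth_onZ => //; exact: smooth_on_cst.
by apply/funext => v; rewrite scaleN1r.
Qed.

Lemma smooth_onB V W (O : set V) (f g : V -> W) :
  open O -> smooth_on O f -> smooth_on O g -> smooth_on O (fun v => f v - g v).
Proof. by move=> oO fs gs; apply: smooth_onD => //; exact: smooth_onN. Qed.

Lemma smooth_onV V (O : set V) (f : V -> R) :
  open O -> (forall v, O v -> f v != 0) -> smooth_on O f ->
  smooth_on O (fun v => (f v)^-1).
Proof. by move=> oO f0 fs k; exact: Ck_onV. Qed.

Lemma smooth_on_lin V W W' (O : set V) (L : {linear W -> W'}) (f : V -> W) :
  continuous L -> open O -> smooth_on O f -> smooth_on O (fun v => L (f v)).
Proof. by move=> cL oO fs k; exact: Ck_on_lin. Qed.

Lemma smooth_on_comp_lin V V' W (O : set V') (O' : set V) (L : {linear V -> V'})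
    (f : V' -> W) : continuous L -> open O' -> (forall v, O' v -> O (L v)) ->
  smooth_on O f -> smooth_on O' (fun v => f (L v)).
Proof. by move=> cL oO' LO fs k; exact: Ck_on_comp_lin (fs k). Qed.

Lemma smooth_on_differentiable V W (O : set V) (f : V -> W) (v : V) :
  smooth_on O f -> O v -> differentiable f v.
Proof. by move=> /(_ 1%N)[fd _]; exact: fd. Qed.

Lemma smooth_on_derive V W (O : set V) (f : V -> W) (w : V) :
  smooth_on O f -> smooth_on O (fun v => 'D_w f v).
Proof. by move=> fs k; have [_] := fs k.+1; exact. Qed.

Lemma smooth_on_sum V W (O : set V) (I : Type) (r : seq I) (P : pred I)
    (F : I -> V -> W) : open O -> (forall i, P i -> smooth_on O (F i)) ->
  smooth_on O (fun v => \sum_(i <- r | P i) F i v).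
Proof.
move=> oO Fs; elim: r => [|i r IHr].
  rewrite (_ : (fun x => _) = fun=> 0); first exact: smooth_on_cst.
  by apply/funext => x; rewrite big_nil.
case Pi : (P i); last first.
  rewrite (_ : (fun x => _) = fun x => \sum_(i <- r | P i) F i x)//.
  by apply/funext => x; rewrite big_cons Pi.
rewrite (_ : (fun x => _) = fun x => F i x + \sum_(i <- r | P i) F i x).
  by apply: smooth_onD => //; exact: Fs.
by apply/funext => x; rewrite big_cons Pi.
Qed.

Lemma smooth_on_prod V (O : set V) (I : Type) (r : seq I) (P : pred I)
    (F : I -> V -> R) : open O -> (forall i, P i -> smooth_on O (F i)) ->
  smooth_on O (fun v => \prod_(i <- r | P i) F i v).
Proof.
move=> oO Fs; elim: r => [|i r IHr].
  rewrite (_ : (fun x => _) = fun=> 1); first exact: smooth_on_cst.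
  by apply/funext => x; rewrite big_nil.
case Pi : (P i); last first.
  rewrite (_ : (fun x => _) = fun x => \prod_(i <- r | P i) F i x)//.
  by apply/funext => x; rewrite big_cons Pi.
rewrite (_ : (fun x => _) = fun x => F i x * \prod_(i <- r | P i) F i x).
  by apply: smooth_onM => //; exact: Fs.
by apply/funext => x; rewrite big_cons Pi.
Qed.

Lemma smooth_on_fst V W W' (O : set V) (f : V -> W * W') :
  open O -> smooth_on O f -> smooth_on O (fun v => (f v).1).
Proof. exact: (smooth_on_lin (L := fst) (@fst_continuous _ W W')). Qed.

Lemma smooth_on_snd V W W' (O : set V) (f : V -> W * W') :
  open O -> smooth_on O f -> smooth_on O (fun v => (f v).2).
Proof. exact: (smooth_on_lin (L := snd) (@snd_continuous _ W W')). Qed.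

Lemma smooth_on_pair V W W' (O : set V) (f : V -> W) (g : V -> W') :
  open O -> smooth_on O f -> smooth_on O g -> smooth_on O (fun v => (f v, g v)).
Proof.
move=> oO fs gs.
pose L1 (w : W) : W * W' := (w, 0); pose L2 (w : W') : W * W' := (0, w).
have l1 : linear L1.
  by move=> a x y; apply: injective_projections => //=; rewrite scaler0 addr0.
have l2 : linear L2.
  by move=> a x y; apply: injective_projections => //=; rewrite scaler0 addr0.
pose LL1 : {linear W -> (W * W')%type} :=
  HB.pack L1 (GRing.isLinear.Build _ _ _ _ L1 l1).
pose LL2 : {linear W' -> (W * W')%type} :=
  HB.pack L2 (GRing.isLinear.Build _ _ _ _ L2 l2).
have c1 : continuous LL1 by move=> x; apply: cvg_pair => //; exact: cvg_cst.
have c2 : continuous LL2 by move=> x; apply: cvg_pair => //; exact: cvg_cst.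
have := smooth_onD oO (smooth_on_lin c1 oO fs) (smooth_on_lin c2 oO gs).
apply: smooth_on_eq => // v _.
by apply: injective_projections; rewrite /= ?addr0 ?add0r.
Qed.

Lemma smooth_on_coord V m n (O : set V) (F : V -> 'M[R]_(m, n)) i j :
  open O -> smooth_on O F -> smooth_on O (fun v => F v i j).
Proof.
pose L (A : 'M[R]_(m, n)) := A i j.
have lL : linear L by move=> a A B; rewrite /L !mxE.
pose LL : {linear 'M[R]_(m, n) -> R} :=
  HB.pack L (GRing.isLinear.Build _ _ _ _ L lL).
exact: (smooth_on_lin (L := LL) (@coord_continuous R m n i j)).
Qed.

Lemma smooth_on_mx V m n (O : set V) (F : V -> 'M[R]_(m, n)) :
  open O -> (forall i j, smooth_on O (fun v => F v i j)) -> smooth_on O F.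
Proof.
move=> oO Fs.
rewrite (_ : F = fun x => \sum_i \sum_j F x i j *: delta_mx i j); last first.
  by apply/funext => x; exact: matrix_sum_delta.
apply: smooth_on_sum => // i _; apply: smooth_on_sum => // j _.
by apply: smooth_onZ => //; exact: smooth_on_cst.
Qed.

Lemma smooth_on_mulmx V m n k (O : set V) (F : V -> 'M[R]_(m, n))
    (G : V -> 'M[R]_(n, k)) :
  open O -> smooth_on O F -> smooth_on O G -> smooth_on O (fun v => F v *m G v).
Proof.
move=> oO Fs Gs; apply: smooth_on_mx => // i j.
rewrite (_ : (fun x => _) = fun x => \sum_l F x i l * G x l j); last first.
  by apply/funext => x; rewrite mxE.
by apply: smooth_on_sum => // l _; apply: smooth_onM => //; exact: smooth_on_coord.
Qed.

Lemma smooth_on_trmx V m n (O : set V) (F : V -> 'M[R]_(m, n)) :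
  open O -> smooth_on O F -> smooth_on O (fun v => (F v)^T).
Proof.
move=> oO Fs; apply: smooth_on_mx => // i j.
rewrite (_ : (fun x => _) = fun x => F x j i); last first.
  by apply/funext => x; rewrite mxE.
exact: smooth_on_coord.
Qed.

Lemma smooth_on_det V n (O : set V) (F : V -> 'M[R]_n) :
  open O -> (forall i j, smooth_on O (fun v => F v i j)) ->
  smooth_on O (fun v => \det (F v)).
Proof.
move=> oO Fs; apply: smooth_on_sum => // s _.
by apply: smooth_onM; [|exact: smooth_on_cst|exact: smooth_on_prod].
Qed.

(** Cramer's rule: the entries of the inverse are cofactors, polynomial in the entries of [F],
    divided by a determinant that does not vanish on [O]. *)
Lemma smooth_on_invmx V n (O : set V) (F : V -> 'M[R]_n) :
  open O -> (forall v, O v -> F v \in unitmx) ->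
  (forall i j, smooth_on O (fun v => F v i j)) ->
  forall i j, smooth_on O (fun v => invmx (F v) i j).
Proof.
move=> oO Fu Fs i j.
have adjs : smooth_on O (fun v => \adj (F v) i j).
  rewrite (_ : (fun v => _) = fun v =>
      (-1) ^+ (j + i) * \det (row' j (col' i (F v)))); last first.
    by apply/funext => v; rewrite mxE.
  apply: smooth_onM => //; first exact: smooth_on_cst.
  apply: smooth_on_det => // k l.
  rewrite (_ : (fun v => _) = fun v => F v (lift j k) (lift i l))//.
  by apply/funext => v; rewrite !mxE.
have detVs : smooth_on O (fun v => (\det (F v))^-1).
  apply: smooth_onV => //; last exact: smooth_on_det.
  by move=> v /Fu; rewrite unitmxE unitfE.
apply: smooth_on_eq (smooth_onM oO detVs adjs) => // v /Fu uF.
by rewrite /invmx uF [RHS]mxE.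
Qed.

End Smooth.

(** * Symmetry of second derivatives *)

Section Schwarz.
Context {R : realType} {V : normedModType R}.

Lemma is_derive_line (g : V -> R) (p u : V) (x : R) :
  differentiable g (p + x *: u) ->
  is_derive x 1 (fun y : R => g (p + y *: u)) ('D_u g (p + x *: u)).
Proof.
move=> /differentiable_is_diff dg.
have dl : is_diff x (fun y : R => p + y *: u) (fun h : R => h *: u).
  apply: (is_diff_eq (is_diffD (is_diff_cst p x)
    (is_diff_scale (is_diff_id x) (is_diff_cst u x)))).
  by apply/funext => h /=; rewrite !fctE scaler0 addr0 add0r.
have dc := is_diff_comp dl dg.
have dgl : derivable (fun y : R => g (p + y *: u)) x 1.
  by apply/diff_derivable; exact: is_diff_differentiable dc.
by apply: (DeriveDef dgl); rewrite (is_diff_derive _ dc) /= scale1r.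
Qed.

Lemma MVT_line (g : V -> R) (p u : V) (s : R) : 0 < s ->
  (forall x : R, 0 <= x <= s -> differentiable g (p + x *: u)) ->
  exists2 x : R, 0 <= x <= s & g (p + s *: u) - g p = s * 'D_u g (p + x *: u).
Proof.
move=> s0 dg.
have [||x] := @MVT R (fun x => g (p + x *: u))
    (fun x => 'D_u g (p + x *: u)) 0 s s0.
- move=> x; rewrite in_itv /= => /andP[x0 xs].
  by apply/is_derive_line/dg; rewrite !ltW.
- apply: derivable_within_continuous => x; rewrite in_itv /= => xs.
  by have [] := is_derive_line (dg x xs).
rewrite in_itv /= => /andP[x0 xs]; rewrite scale0r addr0 subr0 mulrC => H.
by exists x => //; rewrite !ltW.
Qed.

(** The mean value theorem is used twice: along [u] for the increment [g] of [f] in the direction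
    [s *: w], then along [w] for the derivative ['D_u f]. *)
Lemma second_difference (f : V -> R) (v u w : V) (s : R) : 0 < s ->
  (forall x y : R, 0 <= x <= s -> 0 <= y <= s ->
     differentiable f (v + x *: u + y *: w) /\
     differentiable ('D_u f) (v + x *: u + y *: w)) ->
  exists x y : R, [/\ 0 <= x <= s, 0 <= y <= s &
    f (v + s *: u + s *: w) - f (v + s *: u) - f (v + s *: w) + f v =
    s * (s * 'D_w ('D_u f) (v + x *: u + y *: w))].
Proof.
move=> s0 df.
have ss : 0 <= s <= s by rewrite ltW//=.
have z : 0 <= (0 : R) <= s by rewrite lexx ltW.
pose g p := f (p + s *: w) - f p.
have dg p : differentiable f (p + s *: w) -> differentiable f p ->
    is_diff p g (fun h => 'D_h f (p + s *: w) - 'D_h f p).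
  move=> /differentiable_is_diff d1 /differentiable_is_diff d2.
  apply: is_diffB => //.
  have d3 : is_diff p (fun q : V => q + s *: w) id.
    apply: (is_diff_eq (is_diffD (is_diff_id p) (is_diff_cst _ p))).
    by apply/funext => h; rewrite !fctE addr0.
  exact: (is_diff_comp d3 d1).
have dgx x : 0 <= x <= s -> is_diff (v + x *: u) g
    (fun h => 'D_h f (v + x *: u + s *: w) - 'D_h f (v + x *: u)).
  move=> xs; apply: dg; first exact: (df x s xs ss).1.
  by have := (df x 0 xs z).1; rewrite scale0r addr0.
have [x xs gE] := MVT_line s0 (fun x xs => is_diff_differentiable (dgx x xs)).
have [y ys fE] := MVT_line s0 (fun y ys => (df x y xs ys).2).
exists x, y; split => //.
rewrite -fE -(is_diff_derive u (dgx x xs)) -gE /g.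
by rewrite opprB addrA addrAC.
Qed.

(* Both iterated derivatives are limits of the same second difference. *)
Lemma derive_comm (O : set V) (f : V -> R) (u w v : V) :
  open O -> O v -> Ck_on 2 O f -> 'D_u ('D_w f) v = 'D_w ('D_u f) v.
Proof.
move=> oO Ov [fd fC].
have [fud fuC] := fC u; have [fwd fwC] := fC w.
have /cvgrPdist_lt cu := fuC w v Ov.
have /cvgrPdist_lt cw := fwC u v Ov.
apply/eqP; rewrite -subr_eq0 -normr_eq0; apply/eqP/le_anti; rewrite normr_ge0 andbT.
apply/ler_addgt0Pl => e e0; rewrite addr0.
have e2 : 0 < e / 2 by rewrite divr_gt0.
have nO := open_nbhs_nbhs (conj oO Ov).
have /nbhs_ballP[r /= r0 rP] : nbhs v (O `&`
    ([set t | `|'D_w ('D_u f) v - 'D_w ('D_u f) t| < e / 2] `&`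
     [set t | `|'D_u ('D_w f) v - 'D_u ('D_w f) t| < e / 2])).
  by apply: filterI => //; apply: filterI; [exact: cu|exact: cw].
(* This side length keeps the whole parallelogram spanned by [s *: u] and [s *: w] inside the ball
   of radius [r]; the summand 1 keeps the denominator positive when [u] and [w] vanish. *)
pose s := r / 2 / (`|u| + `|w| + 1).
have d0 : 0 < `|u| + `|w| + 1 by rewrite ltr_wpDl ?addr_ge0.
have s0 : 0 < s by rewrite !divr_gt0.
have inball x y : 0 <= x <= s -> 0 <= y <= s -> ball v r (v + x *: u + y *: w).
  move=> /andP[x0 xs] /andP[y0 ys].
  rewrite -ball_normE /= -addrA opprD addrA subrr sub0r normrN.
  apply: (le_lt_trans (ler_normD _ _)); rewrite !normrZ !ger0_norm//.
  have H : x * `|u| + y * `|w| <= s * (`|u| + `|w| + 1).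
    rewrite !mulrDr -[leLHS]addr0; apply: lerD; last by rewrite mulr1 ltW.
    by apply: lerD; exact: ler_wpM2r.
  apply: (le_lt_trans H).
  by rewrite /s divfK ?gt_eqF// ltr_pdivrMr// ltr_pMr// ltr1n.
have inO x y xs ys := (rP _ (inball x y xs ys)).1.
have [x [y [xs ys E1]]] := @second_difference f v u w s s0
  (fun x y xs ys => conj (fd _ (inO x y xs ys)) (fud _ (inO x y xs ys))).
have inball' a b (sa : 0 <= a <= s) (sb : 0 <= b <= s) :
    ball v r (v + a *: w + b *: u).
  by rewrite addrAC; exact: inball.
have inO' a b sa sb := (rP _ (inball' a b sa sb)).1.
have [x' [y' [xs' ys' E2]]] := @second_difference f v w u s s0
  (fun x y xs ys => conj (fd _ (inO' x y xs ys)) (fwd _ (inO' x y xs ys))).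
(* Both values are the same second difference divided by s^2, because it is symmetric in [u] and
   [w]. Each lies within e/2 of its limit at [v]. *)
have EE : 'D_w ('D_u f) (v + x *: u + y *: w) =
    'D_u ('D_w f) (v + x' *: w + y' *: u).
  have sn0 : s != 0 by rewrite gt_eqF.
  apply: (mulfI sn0); apply: (mulfI sn0).
  have E3 : v + s *: u + s *: w = v + s *: w + s *: u by exact: addrAC.
  apply: (etrans (esym E1)); apply: (etrans _ E2); rewrite E3.
  by congr (_ + f v); exact: addrAC.
have B1 := (rP _ (inball x y xs ys)).2.1.
have B2 := (rP _ (inball' x' y' xs' ys')).2.2.
rewrite -[_ - _](subrKA ('D_w ('D_u f) (v + x *: u + y *: w))).
apply: (le_trans (ler_normD _ _)); rewrite (splitr e).
apply: lerD; first by rewrite EE; exact: ltW B2.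
by rewrite distrC; exact: ltW B1.
Qed.

End Schwarz.

(** * Jacobians and transition maps *)

Section Jacobian.
Context {R : realType}.

Lemma row_jacobian m n (f : 'rV[R]_m -> 'rV[R]_n) v i :
  differentiable f v -> row i (jacobian f v) = 'D_(delta_mx 0 i) f v.
Proof. by move=> df; rewrite rowE; apply/esym; exact: deriveEjacobian. Qed.

Lemma jacobian_near m n (f g : 'rV[R]_m -> 'rV[R]_n) (v : 'rV[R]_m) :
  (\near v, f v = g v) -> differentiable f v -> jacobian f v = jacobian g v.
Proof.
move=> fg df; apply/row_matrixP => i.
have dg := is_diff_differentiable (is_diff_near fg (differentiable_is_diff df)).
apply: etrans (row_jacobian i df) (etrans _ (esym (row_jacobian i dg))).
exact: near_eq_derive fg.
Qed.

Lemma jacobian_comp m n k (f : 'rV[R]_m -> 'rV[R]_n) (g : 'rV[R]_n -> 'rV[R]_k) v :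
  differentiable f v -> differentiable g (f v) ->
  jacobian (g \o f) v = jacobian f v *m jacobian g (f v).
Proof.
move=> df dg; have dgf := differentiable_comp df dg.
apply/row_matrixP => i.
apply: etrans (row_jacobian i dgf) (etrans (derive_comp _ df dg) _).
by rewrite row_mul (row_jacobian i df); exact: deriveEjacobian.
Qed.

Lemma jacobian_id m (v : 'rV[R]_m) : jacobian id v = 1%:M.
Proof.
have did : differentiable id v by case: (is_diff_id v).
apply/row_matrixP => i.
by rewrite (row_jacobian i did) (derive_id v) row1.
Qed.

Lemma jacobianE m n (f : 'rV[R]_m -> 'rV[R]_n) v i j :
  differentiable f v ->
  jacobian f v i j = 'D_(delta_mx 0 i) (fun x => f x 0 j) v.
Proof.
move=> df; have := is_diff_coord 0 j (differentiable_is_diff df).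
by move=> /is_diff_derive ->; rewrite -(row_jacobian i df) [RHS]mxE.
Qed.

Lemma jacobian_smooth m n (O : set 'rV[R]_m) (f : 'rV[R]_m -> 'rV[R]_n) i j :
  open O -> smooth_on O f -> smooth_on O (fun v => jacobian f v i j).
Proof.
move=> oO fs; have fsj := smooth_on_coord 0 j oO fs.
apply: smooth_on_eq (smooth_on_derive _ fsj) => // v Ov.
by rewrite jacobianE//; exact: smooth_on_differentiable Ov.
Qed.

Lemma jacobian_sym m n (O : set 'rV[R]_m) (f : 'rV[R]_m -> 'rV[R]_n) v i j k :
  open O -> O v -> smooth_on O f ->
  'D_(delta_mx 0 k) (fun x => jacobian f x j i) v =
  'D_(delta_mx 0 j) (fun x => jacobian f x k i) v.
Proof.
move=> oO Ov fs; have fsi := smooth_on_coord 0 i oO fs.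
have E l h : 'D_h (fun x => jacobian f x l i) v =
    'D_h ('D_(delta_mx 0 l) (fun x => f x 0 i)) v.
  apply: near_eq_derive; apply: filterS (open_nbhs_nbhs (conj oO Ov)) => x Ox.
  by rewrite jacobianE//; exact: smooth_on_differentiable Ox.
by rewrite !E; exact: derive_comm (fsi 2%N).
Qed.

End Jacobian.

#[local] Opaque jacobian.

Section ManifoldAtlas.
Context {R : realType} {d : nat} (X : manifold R d).
Implicit Types a b c : chart (matlas X).

(** Injectivity of [crd a] on its domain leaves a single candidate for the value chosen by
    [xget]. *)
Lemma trans_crd a b x : dom a x -> dom b x -> trans a b (crd a x) = crd b x.
Proof.
move=> ax bx; rewrite /trans; case: xgetP => [w _ [y [ay bY yx <-]]|/(_ (crd b x))].
  by rewrite (mfd_crd_inj ay ax yx).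
by case; exists x.
Qed.

Lemma overlapC a b v : overlap a b v -> overlap b a (trans a b v).
Proof. by move=> [x [ax bx] <-]; rewrite trans_crd//; exists x. Qed.

Lemma transK a b v : overlap a b v -> trans b a (trans a b v) = v.
Proof. by move=> [x [ax bx] <-]; rewrite !trans_crd. Qed.

Lemma overlap_img a b v : overlap a b v -> img a v.
Proof. by move=> [x [ax bx] <-]; exists x. Qed.

Lemma open_img a : open (img a).
Proof.
have [+ _] := mfd_crd_homeo (@subset_refl _ (dom a)).
by apply; exact: mfd_dom_open.
Qed.

Lemma open_overlap a b : open (overlap a b).
Proof.
have [+ _] := mfd_crd_homeo (@subIsetl _ (dom a) (dom b)).
by apply; apply: openI; exact: mfd_dom_open.
Qed.

Lemma trans_differentiable a b v : overlap a b v -> differentiable (trans a b) v.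
Proof. exact: smooth_on_differentiable (mfd_trans_smooth a b). Qed.

Lemma near_overlap a b v : overlap a b v -> \forall w \near v, overlap a b w.
Proof. by move=> abv; apply: open_nbhs_nbhs; split => //; exact: open_overlap. Qed.

(** The composite of the two transitions is the identity on the overlap, which is open, so the chain
    rule applies to an equality holding near [v]. *)
Lemma jacobian_transK a b v : overlap a b v ->
  jacobian (trans a b) v *m jacobian (trans b a) (trans a b v) = 1%:M.
Proof.
move=> abv; have bav := overlapC abv.
rewrite -(jacobian_comp (trans_differentiable abv) (trans_differentiable bav)).
rewrite -(jacobian_id v); apply/esym/jacobian_near; last by case: (is_diff_id v).
by near=> w; rewrite /= transK//; near: w; exact: near_overlap.
Unshelve. all: by end_near. Qed.

Lemma jacobian_trans_unit a b v : overlap a b v ->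
  jacobian (trans a b) v \in unitmx.
Proof. by move=> abv; exact: (mulmx1_unit (jacobian_transK abv)).1. Qed.

Lemma jacobian_trans_inv a b v : overlap a b v ->
  jacobian (trans b a) (trans a b v) = invmx (jacobian (trans a b) v).
Proof.
move=> abv; have uJ := jacobian_trans_unit abv.
by rewrite -[LHS](mulKmx uJ) jacobian_transK// mulmx1.
Qed.

End ManifoldAtlas.

(** * The jet atlas *)

Section JetAtlas.
Context {R : realType} {p n : nat} (T : manifold R p) (M : manifold R n).
Implicit Types (a : chart (matlas T)) (b : chart (matlas M)) (c : jchart T M).
Implicit Types (t : T) (f : T -> M).

Lemma local_rep_crd a b t f s : dom a s -> local_rep a b t f (crd a s) = crd b (f s).
Proof.
move=> as_; rewrite /local_rep; case: xgetP => [r _ [ar /(mfd_crd_inj ar as_) ->//]|].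
by move=> /(_ s); case.
Qed.

(* The last clause is what continuity of [f] at [t] provides; it is stated on
   coordinates because [f] is not assumed continuous. *)
Definition differentiable_rep a b t f : Prop :=
  [/\ dom a t, dom b (f t), differentiable (local_rep a b t f) (crd a t)
    & \forall v \near crd a t, forall s, dom a s -> crd a s = v -> dom b (f s)].

(** Near [crd a' t] the new representative is the old one between two transition maps, and the chain
    rule gives the formula. The work is in showing that nearby points have their images in the two
    target charts, which is deduced from continuity of the old representative. *)
Lemma differentiable_rep_change a b a' b' t f :
    differentiable_rep a b t f -> dom a' t -> dom b' (f t) ->
  differentiable_rep a' b' t f /\
  jacobian (local_rep a' b' t f) (crd a' t) =
    jacobian (trans a' a) (crd a' t) *m jacobian (local_rep a b t f) (crd a t)
      *m jacobian (trans b b') (crd b (f t)).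
Proof.
move=> [at_ bft df nb] a't b'ft.
have aa' : overlap a' a (crd a' t) by exists t.
have bb' : overlap b b' (crd b (f t)) by exists (f t).
have d1 : differentiable (trans a' a) (crd a' t) by exact: trans_differentiable.
have tE : trans a' a (crd a' t) = crd a t by exact: trans_crd.
have c1 : trans a' a v @[v --> crd a' t] --> crd a t.
  by rewrite -[X in _ --> X]tE; exact: differentiable_continuous.
have d3 : differentiable (trans b b') (local_rep a b t f (crd a t)).
  by rewrite local_rep_crd//; exact: trans_differentiable.
have c2 : local_rep a b t f v @[v --> crd a t] --> crd b (f t).
  by rewrite -(local_rep_crd b t f at_); exact: differentiable_continuous.
have d2 : differentiable (local_rep a b t f) (trans a' a (crd a' t)) by rewrite tE.
have n1 : \forall v \near crd a' t,
    forall s, dom a s -> crd a s = trans a' a v -> dom b (f s) by exact: c1 nb.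
have m2 : \forall x \near crd a t, overlap b b' (local_rep a b t f x).
  by exact: c2 (near_overlap bb').
have n2 : \forall v \near crd a' t,
    overlap b b' (local_rep a b t f (trans a' a v)).
  by exact: c1 m2.
have n3 := near_overlap aa'.
(* Membership of [f s] in [dom b'] is read off coordinates: [crd b (f s)] lies in the overlap, hence
   is the coordinate of some point of both charts, and injectivity of [crd b] makes that point
   [f s]. *)
have n4 : \forall v \near crd a' t, forall s, dom a' s -> crd a' s = v ->
    dom b' (f s) /\ local_rep a' b' t f v =
      trans b b' (local_rep a b t f (trans a' a v)).
  near=> v => s a's sv.
  have [r [a'r ar rv]] : overlap a' a v by near: v.
  have rs : r = s by apply: mfd_crd_inj a'r a's _; rewrite rv sv.
  subst r.
  have tv : trans a' a v = crd a s by rewrite -sv trans_crd.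
  have bfs : dom b (f s).
    have H : forall s, dom a s -> crd a s = trans a' a v -> dom b (f s) by near: v.
    exact: H.
  have : overlap b b' (local_rep a b t f (trans a' a v)) by near: v.
  rewrite tv local_rep_crd// => -[y [by_ b'y /(mfd_crd_inj by_ bfs) yE]].
  subst y; split=> //.
  by rewrite -sv local_rep_crd// trans_crd.
have n5 : \forall v \near crd a' t, (trans b b' \o local_rep a b t f \o trans a' a) v
    = local_rep a' b' t f v.
  near=> v.
  have [s [a's as_ sv]] : overlap a' a v by near: v.
  have H : forall s, dom a' s -> crd a' s = v ->
    dom b' (f s) /\ local_rep a' b' t f v =
      trans b b' (local_rep a b t f (trans a' a v)) by near: v.
  by rewrite (H s a's sv).2.
have d23 : differentiable (trans b b' \o local_rep a b t f) (trans a' a (crd a' t)).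
  by apply: differentiable_comp => //; rewrite tE.
have d123 := differentiable_comp d1 d23.
split.
  split; [exact: a't|exact: b'ft| |].
    exact: is_diff_differentiable (is_diff_near n5 (differentiable_is_diff d123)).
  by apply: filterS n4 => v H s a's sv; exact: (H s a's sv).1.
rewrite -(jacobian_near n5 d123) (jacobian_comp d1 d23) -mulmxA; congr (_ *m _).
rewrite tE; apply: etrans (jacobian_comp df d3) _.
by rewrite (local_rep_crd b t f at_).
Unshelve. all: by end_near. Qed.

(** [smooth_near] speaks of one pair of charts; the change of charts carries differentiability to
    every other pair around the point. *)
Lemma smooth_near_differentiable a b t f :
  smooth_near t f -> dom a t -> dom b (f t) -> differentiable_rep a b t f.
Proof.
move=> [a0 [b0 [U [a0t [oO Ot] Oa Ob fs]]]] at_ bft.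
suff H0 : differentiable_rep a0 b0 t f.
  by have [] := differentiable_rep_change H0 at_ bft.
split=> //; first exact: Ob.
  exact: smooth_on_differentiable fs Ot.
apply: filterS (open_nbhs_nbhs (conj oO Ot)) => v Ov s a0s sv.
by apply: Ob => //; rewrite sv.
Qed.

Lemma jet_map_smooth (e : jet1 T M) : smooth_near (jet_src e) (jet_map e).
Proof. by rewrite /jet_map; case: cid => f /= []. Qed.

(** This is the chain rule for the map representing [e]. The transposes arise because the rows of
    [jacobian] are indexed by the source, those of x^i_al by the target. *)
Lemma crd_jet_change c c' (e : jet1 T M) (J := jacT c c' (crd c e))
    (K := jacM c c' (crd c e)) : dom c e -> dom c' e ->
  crd c' e = (trans c.1 c'.1 (crd c e).1.1, trans c.2 c'.2 (crd c e).1.2,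
              K^T *m (crd c e).2 *m (invmx J)^T).
Proof.
move=> [ae be] [a'e b'e].
have rep := smooth_near_differentiable (jet_map_smooth e) ae be.
have [_ E] := differentiable_rep_change rep a'e b'e.
rewrite /= !trans_crd// E; congr (_, _).
have o1 : overlap c.1 c'.1 (crd c.1 (jet_src e)) by exists (jet_src e).
rewrite !trmx_mul mulmxA.
have -> : jacobian (trans c'.1 c.1) (crd c'.1 (jet_src e)) = invmx J.
  by rewrite -(jacobian_trans_inv o1) trans_crd.
by [].
Qed.

Lemma trans_jet c c' v : overlap c c' v ->
  [/\ overlap c.1 c'.1 v.1.1, overlap c.2 c'.2 v.1.2
    & trans c c' v = (trans c.1 c'.1 v.1.1, trans c.2 c'.2 v.1.2,
        (jacM c c' v)^T *m v.2 *m (invmx (jacT c c' v))^T)].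
Proof.
move=> [e [[ae be] [a'e b'e] ev]]; split.
- by rewrite -ev; exists (jet_src e).
- by rewrite -ev; exists (jet_map e (jet_src e)).
rewrite /trans; case: xgetP => [w _ [e' [ce' c'e' <- <-]]|/(_ (crd c' e))].
  exact: crd_jet_change.
by case; exists e.
Qed.

Lemma overlap_jet_img c c' v : overlap c c' v -> img c' (trans c c' v).
Proof.
move=> [e [ce c'e ev]].
rewrite /trans; case: xgetP => [w _ [e' [ce' c'e' _ <-]]|/(_ (crd c' e))].
  by exists e'.
by case; exists e.
Qed.

Lemma overlap_jet_img1 c c' v : overlap c c' v -> img c v.
Proof. by move=> [e [ce _ ev]]; exists e. Qed.

Lemma img_jetP c v : img c v <-> img c.1 v.1.1 /\ img c.2 v.1.2.
Proof.
split=> [[e [ae be] <-]|[[t at_ tv] [q bq qv]]].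
  by split; [exists (jet_src e)|exists (jet_map e (jet_src e))].
(* The affine map with the prescribed value [v.1.2] and first derivatives [v.2] at [v.1.1]. Its lift
   [f] to the manifolds takes the default value [q] where [F] leaves the image of the chart; such
   points are excluded from [O]. *)
pose F (x : 'rV[R]_p) : 'rV[R]_n := v.1.2 + (x - v.1.1) *m v.2^T.
have FF (x : 'rV[R]_p) : is_diff x F (fun w => w *m v.2^T).
  apply: (is_diff_eq (is_diffD (is_diff_cst _ x) (is_diff_mulmx
    (is_diffB (is_diff_id x) (is_diff_cst v.1.1 x)) (is_diff_cst _ x)))).
  by apply/funext => w; rewrite !fctE mulmx0 addr0 add0r subr0.
pose f (s : T) : M := xget q [set r | dom c.2 r /\ crd c.2 r = F (crd c.1 s)].
pose O := img c.1 `&` F @^-1` (img c.2).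
have fO s : O (crd c.1 s) -> dom c.2 (f s) /\ crd c.2 (f s) = F (crd c.1 s).
  move=> [_ [r br rF]]; rewrite /f; case: xgetP => [r' _ //|/(_ r)].
  by case.
have Fv : F v.1.1 = v.1.2 by rewrite /F subrr mul0mx addr0.
have Ot : O (crd c.1 t).
  by rewrite tv; split; [exists t|rewrite /= Fv; exists q].
have oO : open O.
  apply: openI; first exact: open_img.
  apply: open_comp; last exact: open_img.
  by move=> x _; apply: differentiable_continuous; exact: is_diff_differentiable (FF x).
have repE x : O x -> F x = local_rep c.1 c.2 t f x.
  by move=> Ox; have [s as_ sx] := Ox.1; rewrite -sx local_rep_crd// (fO s _).2// sx.
have fs : smooth_near t f.
  exists c.1, c.2, O; split=> //; first by move=> x [].
    by move=> s _ /fO[].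
  apply: smooth_on_eq repE _ => //; apply: smooth_onD => //; first exact: smooth_on_cst.
  apply: smooth_on_mulmx => //; last exact: smooth_on_cst.
  by apply: smooth_onB => //; [exact: smooth_on_id|exact: smooth_on_cst].
pose cl := [set f' | smooth_near t f' /\ same_jet t f f'].
pose e : jet1 T M := Jet1 (ex_intro _ f (conj fs (erefl cl))).
(* [jet_map e] is an arbitrary choice in the class and need not be [f]; having the same jet at [t]
   is all that the coordinates of [e] depend on. *)
have [fte jte] : same_jet t (jet_map e) f.
  rewrite /jet_map; case: cid => f' /= [_ clE].
  by have : cl f by []; rewrite clE => -[].
have [bft ftv] := fO t Ot.
exists e; first by split=> //=; rewrite fte.
rewrite /= fte jte ?fte// ftv tv Fv.
have nF : \forall x \near v.1.1, F x = local_rep c.1 c.2 t f x.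
  by rewrite -tv; apply: filterS (open_nbhs_nbhs (conj oO Ot)); exact: repE.
have <- := jacobian_near nF (is_diff_differentiable (FF _)).
have -> : jacobian F v.1.1 = v.2^T.
  apply/row_matrixP => i; have dF := is_diff_differentiable (FF v.1.1).
  by apply: etrans (row_jacobian i dF) _; rewrite (is_diff_derive _ (FF _)) rowE.
by rewrite trmxK; case: (v) => -[].
Qed.

Lemma open_jet_img c : open (img c).
Proof.
rewrite (_ : img c = (fun v : jcoord R p n => v.1.1) @^-1` img c.1 `&`
                     (fun v : jcoord R p n => v.1.2) @^-1` img c.2).
  apply: openI; apply: open_comp; try exact: open_img; move=> v _.
    by apply: continuous_comp; exact: fst_continuous.
  by apply: continuous_comp; [exact: fst_continuous|exact: snd_continuous].
by apply/seteqP; split=> v /img_jetP.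
Qed.

End JetAtlas.

(** * Transition maps of the jet bundle and their differentials *)

Section JetTransition.
Context {R : realType} {p n : nat} {T : manifold R p} {M : manifold R n}.
Implicit Types (c : jchart T M) (v w : jcoord R p n).

(** The fibre coordinate is unconstrained by [img_jetP]. Given a jet with coordinates [v],
    injectivity of the base charts identifies its source and target with the points witnessing the
    two overlaps. *)
Lemma overlap_jetP c c' v :
  overlap c c' v <-> overlap c.1 c'.1 v.1.1 /\ overlap c.2 c'.2 v.1.2.
Proof.
split=> [/trans_jet[]//|[tv xv]].
have [|e [ae be] ev] := (img_jetP c v).2.
  by split; [exact: overlap_img tv|exact: overlap_img xv].
exists e => //; split=> //; split.
  have [s [as_ a's sv]] := tv.
  by rewrite (mfd_crd_inj ae as_ _)// sv -ev.
have [s [as_ a's sv]] := xv.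
by rewrite (mfd_crd_inj be as_ _)// sv -ev.
Qed.

Lemma open_jet_overlap c c' : open (overlap c c').
Proof.
rewrite (_ : overlap c c' =
    (fun v : jcoord R p n => v.1.1) @^-1` overlap c.1 c'.1 `&`
    (fun v : jcoord R p n => v.1.2) @^-1` overlap c.2 c'.2).
  apply: openI; apply: open_comp; try exact: open_overlap; move=> v _.
    by apply: continuous_comp; exact: fst_continuous.
  by apply: continuous_comp; [exact: fst_continuous|exact: snd_continuous].
by apply/seteqP; split=> v /overlap_jetP.
Qed.

Lemma near_jet_overlap c c' v :
  overlap c c' v -> \forall x \near v, overlap c c' x.
Proof.
by move=> cv; apply: open_nbhs_nbhs; split => //; exact: open_jet_overlap.
Qed.

Lemma jacT_unit c c' v : overlap c c' v -> jacT c c' v \in unitmx.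
Proof. by move=> /overlap_jetP[tv _]; exact: jacobian_trans_unit. Qed.

Lemma jacM_unit c c' v : overlap c c' v -> jacM c c' v \in unitmx.
Proof. by move=> /overlap_jetP[_ xv]; exact: jacobian_trans_unit. Qed.

Lemma is_diff_t v : is_diff v (fun x : jcoord R p n => x.1.1) (fun w => w.1.1).
Proof. exact: is_diff_fst (is_diff_fst (is_diff_id v)). Qed.

Lemma is_diff_x v : is_diff v (fun x : jcoord R p n => x.1.2) (fun w => w.1.2).
Proof. exact: is_diff_snd (is_diff_fst (is_diff_id v)). Qed.

Lemma is_diff_y v : is_diff v (fun x : jcoord R p n => x.2) (fun w => w.2).
Proof. exact: is_diff_snd (is_diff_id v). Qed.

Lemma is_diff_jacobian_trans d (X : manifold R d) (a b : chart (matlas X)) x :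
  overlap a b x ->
  is_diff x (jacobian (trans a b)) (fun u => 'D_u (jacobian (trans a b)) x).
Proof.
move=> abx; apply: differentiable_is_diff.
have J i j : is_diff x (fun y => jacobian (trans a b) y i j)
    (fun u => 'D_u (fun y => jacobian (trans a b) y i j) x).
  apply: differentiable_is_diff.
  apply: smooth_on_differentiable (jacobian_smooth i j _ (mfd_trans_smooth a b)) abx.
  exact: open_overlap.
apply: (@is_diff_differentiable _ _ _ _
  (fun u => \matrix_(i, j) 'D_u (fun y => jacobian (trans a b) y i j) x)).
apply: is_diff_mx => i j; apply: (is_diff_eq (J i j)).
by apply/funext => u; rewrite mxE.
Qed.

Lemma is_diff_jacT c c' v : overlap c c' v ->
  is_diff v (jacT c c') (fun w => 'D_(w.1.1) (jacobian (trans c.1 c'.1)) v.1.1).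
Proof.
move=> /overlap_jetP[tv _].
exact: (is_diff_comp (is_diff_t v) (is_diff_jacobian_trans tv)).
Qed.

Lemma is_diff_jacM c c' v : overlap c c' v ->
  is_diff v (jacM c c') (fun w => 'D_(w.1.2) (jacobian (trans c.2 c'.2)) v.1.2).
Proof.
move=> /overlap_jetP[_ xv].
exact: (is_diff_comp (is_diff_x v) (is_diff_jacobian_trans xv)).
Qed.

(** Differentiability comes from the smoothness of the inverse; the value of the differential is
    then forced by differentiating J J^-1 = 1 near [x]. *)
Lemma is_diff_invmx_jacobian d (X : manifold R d) (a b : chart (matlas X)) x
    (J := jacobian (trans a b)) : overlap a b x ->
  is_diff x (fun y => invmx (J y))
    (fun u => - (invmx (J x) *m 'D_u J x *m invmx (J x))).
Proof.
move=> abx; have uJ := jacobian_trans_unit abx.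
have sI : smooth_on (overlap a b) (fun y => invmx (J y)).
  apply: smooth_on_mx => [|i j]; first exact: open_overlap.
  have sJ k l : smooth_on (overlap a b) (fun y => J y k l).
    exact: (jacobian_smooth k l (@open_overlap _ _ _ a b) (mfd_trans_smooth a b)).
  exact: (smooth_on_invmx (@open_overlap _ _ _ a b)
    (fun y => @jacobian_trans_unit _ _ _ a b y) sJ).
have dI := differentiable_is_diff (smooth_on_differentiable sI abx).
have dJ := is_diff_jacobian_trans abx.
apply: (is_diff_eq dI); apply/funext => u.
have n1 : \forall y \near x, 1%:M = J y *m invmx (J y).
  apply: filterS (near_overlap abx) => y aby.
  exact: esym (mulmxV (jacobian_trans_unit aby)).
have := is_diff_derive u (is_diff_mulmx dJ dI).
rewrite -(near_eq_derive u n1) derive_cst => /esym/eqP.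
rewrite addrC addr_eq0 => /eqP /(congr1 (mulmx (invmx (J x)))).
by rewrite (mulKmx uJ) mulmxN mulmxA.
Qed.

Lemma is_diff_invmx_jacT c c' v : overlap c c' v ->
  is_diff v (fun x => invmx (jacT c c' x))
    (fun w => - (invmx (jacT c c' v) *m
       'D_(w.1.1) (jacobian (trans c.1 c'.1)) v.1.1 *m invmx (jacT c c' v))).
Proof.
move=> /overlap_jetP[tv _].
exact: (is_diff_comp (is_diff_t v) (is_diff_invmx_jacobian tv)).
Qed.

(** The derivatives of [K] and of the inverse of [J] are left symbolic; both vanish in vertical
    directions, where the formula is evaluated. *)
Lemma is_diff_trans_jet c c' v (J := jacT c c') (K := jacM c c') :
  overlap c c' v ->
  is_diff v (trans c c') (fun w => ('D_(w.1.1) (trans c.1 c'.1) v.1.1,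
    'D_(w.1.2) (trans c.2 c'.2) v.1.2,
    ('D_w K v)^T *m v.2 *m (invmx (J v))^T + (K v)^T *m w.2 *m (invmx (J v))^T
    + (K v)^T *m v.2 *m ('D_w (fun x => invmx (J x)) v)^T)).
Proof.
move=> cv; have [tv xv] := (overlap_jetP c c' v).1 cv.
have nE : \forall x \near v, (trans c.1 c'.1 x.1.1, trans c.2 c'.2 x.1.2,
    (K x)^T *m x.2 *m (invmx (J x))^T) = trans c c' x.
  by apply: filterS (near_jet_overlap cv) => x /trans_jet[_ _ ->].
apply: is_diff_near nE _.
have d1 := is_diff_comp (is_diff_t v)
  (differentiable_is_diff (trans_differentiable tv)).
have d2 := is_diff_comp (is_diff_x v)
  (differentiable_is_diff (trans_differentiable xv)).
have dK : is_diff v K (fun w => 'D_w K v).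
  by apply/differentiable_is_diff; exact: is_diff_differentiable (is_diff_jacM cv).
have dJ : is_diff v (fun x => invmx (J x)) (fun w => 'D_w (fun x => invmx (J x)) v).
  apply/differentiable_is_diff; apply: is_diff_differentiable.
  exact: is_diff_invmx_jacT cv.
have d3 := is_diff_mulmx (is_diff_mulmx (is_diff_trmx dK) (is_diff_y v))
  (is_diff_trmx dJ).
apply: (is_diff_eq (is_diff_pair (is_diff_pair d1 d2) d3)).
by apply/funext => w /=; congr (_, _); rewrite !mulmxDl.
Qed.

End JetTransition.

(** * Adapted frames *)

Section AdaptedBasis.
Context {R : realType} {p n : nat}.
Notation V := (jcoord R p n).

Lemma sum_e_t (a : 'I_p -> R) :
  \sum_al a al *: e_t R n al = (\row_al a al, 0, 0) :> V.
Proof.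
apply: injective_projections; [apply: injective_projections|].
- rewrite !raddf_sum /=; apply/rowP => j; rewrite summxE mxE (bigD1 j)//= big1.
    by rewrite !mxE !eqxx mulr1 addr0.
  by move=> i ij; rewrite !mxE eq_sym (negbTE ij) andbF mulr0.
- by rewrite !raddf_sum /=; apply: big1 => i _; rewrite scaler0.
- by rewrite !raddf_sum /=; apply: big1 => i _; rewrite scaler0.
Qed.

Lemma sum_e_x (b : 'I_n -> R) :
  \sum_i b i *: e_x R p i = (0, \row_i b i, 0) :> V.
Proof.
apply: injective_projections; [apply: injective_projections|].
- by rewrite !raddf_sum /=; apply: big1 => i _; rewrite scaler0.
- rewrite !raddf_sum /=; apply/rowP => j; rewrite summxE mxE (bigD1 j)//= big1.
    by rewrite !mxE !eqxx mulr1 addr0.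
  by move=> i ij; rewrite !mxE eq_sym (negbTE ij) andbF mulr0.
- by rewrite !raddf_sum /=; apply: big1 => i _; rewrite scaler0.
Qed.

Lemma sum_dv (y : 'I_n -> 'I_p -> R) :
  \sum_i \sum_al y i al *: dv i al = (0, 0, \matrix_(i, al) y i al) :> V.
Proof.
apply: injective_projections; [apply: injective_projections|].
- rewrite !raddf_sum /=; apply: big1 => i _.
  by rewrite !raddf_sum /=; apply: big1 => al _; rewrite scaler0.
- rewrite !raddf_sum /=; apply: big1 => i _.
  by rewrite !raddf_sum /=; apply: big1 => al _; rewrite scaler0.
- rewrite raddf_sum /= [RHS]matrix_sum_delta; apply: eq_bigr => i _.
  by rewrite raddf_sum /=; apply: eq_bigr => al _; rewrite mxE.
Qed.

Lemma jcoord_basis (w : V) : w = \sum_al w.1.1 0 al *: e_t R n al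
  + \sum_i w.1.2 0 i *: e_x R p i + \sum_i \sum_al w.2 i al *: dv i al.
Proof.
rewrite sum_e_t sum_e_x sum_dv.
apply: injective_projections; [apply: injective_projections|]; rewrite /=.
- by rewrite !addr0; apply/rowP => i; rewrite mxE.
- by rewrite addr0 add0r; apply/rowP => i; rewrite mxE.
- by rewrite !add0r; apply/matrixP => i j; rewrite mxE.
Qed.

Lemma jcoord_linear_ext (W : lmodType R) (f g : {linear V -> W}) :
    (forall al, f (e_t R n al) = g (e_t R n al)) ->
    (forall i, f (e_x R p i) = g (e_x R p i)) ->
    (forall i al, f (dv i al) = g (dv i al)) ->
  f =1 g.
Proof.
move=> ft fx fy w; rewrite (jcoord_basis w) !linearD !linear_sum /=.
congr (_ + _ + _); apply: eq_bigr => i _.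
- by rewrite !linearZ /= ft.
- by rewrite !linearZ /= fx.
- by rewrite !linear_sum; apply: eq_bigr => al _; rewrite !linearZ /= fy.
Qed.

End AdaptedBasis.

(** * Components of tangent vectors in the adapted frame *)

Section Frame.
Context {R : realType} {p n : nat} {T : manifold R p} {M : manifold R n}.
Variable Gam : nonlinear_connection T M.
Notation V := (jcoord R p n).
Implicit Types (c : jchart T M) (v w : V).

(** Since d/dt^al = delta/delta t^al + M d/dx^j_be, and similarly for x^i with N, this is what the
    vertical components gain when a coordinate vector is rewritten in the adapted frame. *)
Definition horizontal_part c v w : 'M[R]_(n, p) :=
  \matrix_(j, be) (\sum_al w.1.1 0 al * nlM Gam c v j be al
                   + \sum_i w.1.2 0 i * nlN Gam c v j be i).

Definition to_adapted c v w : V := (w.1.1, w.1.2, w.2 + horizontal_part c v w).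

Definition of_adapted c v w : V := (w.1.1, w.1.2, w.2 - horizontal_part c v w).

Lemma to_adaptedK c v : cancel (to_adapted c v) (of_adapted c v).
Proof. by case=> -[a b] y; rewrite /to_adapted /of_adapted /= addrK. Qed.

Lemma of_adaptedK c v : cancel (of_adapted c v) (to_adapted c v).
Proof. by case=> -[a b] y; rewrite /to_adapted /of_adapted /= subrK. Qed.

Lemma horizontal_part_linear c v : linear (horizontal_part c v).
Proof.
move=> a x y; apply/matrixP => i j; rewrite !mxE mulrDr !mulr_sumr.
rewrite addrACA -!big_split; congr (_ + _); apply: eq_bigr => k _;
  by rewrite !mxE mulrDl mulrA.
Qed.

Lemma to_adapted_linear c v : linear (to_adapted c v).
Proof.
move=> a x y; apply: injective_projections => //=.
by rewrite horizontal_part_linear scalerDr addrACA.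
Qed.

Lemma of_adapted_linear c v : linear (of_adapted c v).
Proof.
move=> a x y; apply: (can_inj (to_adaptedK c v)); rewrite of_adaptedK.
by rewrite to_adapted_linear !of_adaptedK.
Qed.

HB.instance Definition _ c v :=
  GRing.isLinear.Build R V V _ (to_adapted c v) (to_adapted_linear c v).
HB.instance Definition _ c v :=
  GRing.isLinear.Build R V V _ (of_adapted c v) (of_adapted_linear c v).

Lemma of_adapted_t c v al : of_adapted c v (e_t R n al) = dt Gam c al v.
Proof.
rewrite /dt /dt_of sum_dv /of_adapted /=.
apply: injective_projections; [apply: injective_projections|]; rewrite /= ?subr0//.
congr (_ - _); apply/matrixP => i j; rewrite !mxE [X in _ + X]big1 ?addr0.
  rewrite (bigD1 al)//= big1 ?addr0; first by rewrite !mxE !eqxx mul1r.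
  by move=> k kal; rewrite !mxE (negbTE kal) andbF mul0r.
by move=> k _; rewrite mxE mul0r.
Qed.

Lemma of_adapted_x c v i : of_adapted c v (e_x R p i) = dx Gam c i v.
Proof.
rewrite /dx /dx_of sum_dv /of_adapted /=.
apply: injective_projections; [apply: injective_projections|]; rewrite /= ?subr0//.
congr (_ - _); apply/matrixP => k j; rewrite !mxE big1 ?add0r.
  rewrite (bigD1 i)//= big1 ?addr0; first by rewrite !mxE !eqxx mul1r.
  by move=> l li; rewrite !mxE (negbTE li) andbF mul0r.
by move=> l _; rewrite mxE mul0r.
Qed.

Lemma of_adapted_y c v i al : of_adapted c v (dv i al) = dv i al.
Proof.
apply: injective_projections => //=.
suff -> : horizontal_part c v (dv i al) = 0 by rewrite subr0.
apply/matrixP => k l; rewrite !mxE !big1 ?addr0// => j _; by rewrite mxE mul0r.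
Qed.

(** The tensorial change law of adapted components: contravariant in t, contravariant in x, and for
    the vertical block contravariant in i, covariant in al. No derivative of a Jacobian occurs. *)
Definition adapted_change c c' v w : V :=
  (w.1.1 *m jacT c c' v, w.1.2 *m jacM c c' v,
   (jacM c c' v)^T *m w.2 *m (invmx (jacT c c' v))^T).

Lemma adapted_change_linear c c' v : linear (adapted_change c c' v).
Proof.
move=> a x y; apply: injective_projections; [apply: injective_projections|].
- by rewrite /= mulmxDl -scalemxAl.
- by rewrite /= mulmxDl -scalemxAl.
- by rewrite /= mulmxDr -scalemxAr mulmxDl -scalemxAl.
Qed.

HB.instance Definition _ c c' v :=
  GRing.isLinear.Build R V V _ (adapted_change c c' v) (adapted_change_linear c c' v).

Lemma adapted_change_t c c' v al :
  adapted_change c c' v (e_t R n al) = \sum_be jacT c c' v al be *: e_t R n be.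
Proof.
rewrite sum_e_t /adapted_change /= -rowE mul0mx mulmx0 mul0mx.
by congr (_, _, _); apply/rowP => i; rewrite !mxE.
Qed.

Lemma adapted_change_x c c' v i :
  adapted_change c c' v (e_x R p i) = \sum_j jacM c c' v i j *: e_x R p j.
Proof.
rewrite sum_e_x /adapted_change /= -rowE mul0mx mulmx0 mul0mx.
by congr (_, _, _); apply/rowP => j; rewrite !mxE.
Qed.

Lemma adapted_change_y c c' v i al :
  adapted_change c c' v (dv i al) =
  \sum_j \sum_be (jacM c c' v i j * invmx (jacT c c' v) be al) *: dv j be.
Proof.
rewrite sum_dv /adapted_change /= !mul0mx; congr (_, _, _).
apply/matrixP => j be; rewrite !mxE (bigD1 al)//= big1 ?addr0 => [|k kal].
  rewrite mxE (bigD1 i)//= big1 ?addr0 => [|k ki].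
    by rewrite !mxE !eqxx mulr1.
  by rewrite !mxE (negbTE ki) mulr0.
rewrite mxE big1 ?mul0r// => l _.
by rewrite !mxE (negbTE kal) andbF mulr0.
Qed.

Lemma trans_jet_differentiable c c' v :
  overlap c c' v -> differentiable (trans c c') v.
Proof. by move=> cv; exact: is_diff_differentiable (is_diff_trans_jet cv). Qed.

(** Both sides are linear in [u], so basis vectors suffice. On the horizontal ones this is the
    tensoriality required of [Gam]; on the vertical ones the differential of the jet transition is
    explicit and the derivatives of [J] and [K] drop out. *)
Lemma derive_trans_adapted c c' v u : overlap c c' v ->
  'D_(of_adapted c v u) (trans c c') v =
  of_adapted c' (trans c c' v) (adapted_change c c' v u).
Proof.
move=> cv; have dtr := trans_jet_differentiable cv.
rewrite (deriveE _ dtr).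
pose f : {linear V -> V} := 'd (trans c c') v \o of_adapted c v.
pose g : {linear V -> V} := of_adapted c' (trans c c' v) \o adapted_change c c' v.
suff : f =1 g by exact.
apply: jcoord_linear_ext => [al|i|i al]; rewrite /f /g /= -(deriveE _ dtr).
- rewrite of_adapted_t adapted_change_t linear_sum (nl_dt_tensor Gam cv al).
  by apply: eq_bigr => be _; rewrite linearZ /= of_adapted_t.
- rewrite of_adapted_x adapted_change_x linear_sum (nl_dx_tensor Gam cv i).
  by apply: eq_bigr => j _; rewrite linearZ /= of_adapted_x.
rewrite of_adapted_y (is_diff_derive _ (is_diff_trans_jet cv)) /=.
rewrite !derive0 (is_diff_derive _ (is_diff_jacM cv)) /= derive0.
rewrite (is_diff_derive _ (is_diff_invmx_jacT cv)) /= derive0.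
rewrite mulmx0 mul0mx oppr0 !trmx0 !mul0mx mulmx0 addr0 add0r.
rewrite /adapted_change /= !mul0mx /of_adapted /=.
suff -> : forall y, horizontal_part c' (trans c c' v) (0, 0, y) = 0 by rewrite subr0.
move=> y; apply/matrixP => k l; rewrite !mxE !big1 ?addr0// => j _;
  by rewrite mxE mul0r.
Qed.

Lemma derive_trans_y c c' v i al : overlap c c' v ->
  'D_(dv i al) (trans c c') v =
  \sum_j \sum_be (jacM c c' v i j * invmx (jacT c c' v) be al) *: dv j be.
Proof.
move=> cv; rewrite -{1}(of_adapted_y c v) derive_trans_adapted// adapted_change_y.
rewrite linear_sum; apply: eq_bigr => j _; rewrite linear_sum.
by apply: eq_bigr => be _; rewrite linearZ /= of_adapted_y.
Qed.

End Frame.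

(** * Matrix identities for changes of frame *)

Lemma sum_mulmx_scale (R : pzRingType) (W : lmodType R) m k (u : 'rV[R]_m)
    (A : 'M[R]_(m, k)) (Q : 'I_k -> W) :
  \sum_l (u *m A) 0 l *: Q l = \sum_i u 0 i *: \sum_l A i l *: Q l.
Proof.
under [RHS]eq_bigr do rewrite scaler_sumr.
rewrite exchange_big; apply: eq_bigr => l _.
by rewrite mxE scaler_suml; apply: eq_bigr => i _; rewrite scalerA.
Qed.

Lemma sum_mulmx_scale2 (R : comPzRingType) (W : lmodType R) m k m' k'
    (y : 'M[R]_(m, k)) (A : 'M[R]_(m, m')) (B : 'M[R]_(k', k))
    (Q : 'I_m' -> 'I_k' -> W) :
  \sum_l \sum_j (A^T *m y *m B^T) l j *: Q l j =
  \sum_i \sum_r y i r *: \sum_l A i l *: \sum_j B j r *: Q l j.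
Proof.
transitivity (\sum_l \sum_j \sum_i \sum_r (y i r * A i l * B j r) *: Q l j).
  apply: eq_bigr => l _; apply: eq_bigr => j _.
  rewrite mxE exchange_big scaler_suml; apply: eq_bigr => r _.
  rewrite mxE mulr_suml scaler_suml; apply: eq_bigr => i _.
  by rewrite !mxE [A i l * _]mulrC.
rewrite pair_bigA /=; under eq_bigr do rewrite pair_bigA /=.
rewrite exchange_big [RHS]pair_bigA; apply: eq_bigr => -[i r] _ /=.
rewrite scaler_sumr -[LHS](pair_bigA _ (fun l j => (y i r * A i l * B j r) *: Q l j)).
apply: eq_bigr => l _; rewrite !scaler_sumr; apply: eq_bigr => j _.
by rewrite !scalerA.
Qed.

(** A vertical component is covariant in al, so the law of [A] enters through its dual J^-1 A = J^-1
    dJ J^-1 + A' J^-1. The inhomogeneous term with its sign is the derivative of J^-1. *)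
Lemma vertical_form_change (R : comUnitRingType) p n (A A' dJ J : 'M[R]_p)
    (B B' dK K : 'M[R]_n) (y : 'M[R]_(n, p)) : J \in unitmx ->
  A *m J = dJ + J *m A' -> B *m K = dK + K *m B' ->
  K^T *m (B^T *m y - y *m A^T) *m (invmx J)^T =
  dK^T *m y *m (invmx J)^T
    + K^T *m y *m (- (invmx J *m dJ *m invmx J))^T
    + (B'^T *m (K^T *m y *m (invmx J)^T)
       - K^T *m y *m (invmx J)^T *m A'^T).
Proof.
move=> uJ AE BE.
have IA : invmx J *m A = invmx J *m dJ *m invmx J + A' *m invmx J.
  rewrite -{1}(mulmxK uJ A) AE mulmxDl mulmxDr !mulmxA; congr (_ + _).
  by rewrite (mulVmx uJ) mul1mx.
have -> : K^T *m (B^T *m y - y *m A^T) *m (invmx J)^T =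
    (B *m K)^T *m y *m (invmx J)^T - K^T *m y *m (invmx J *m A)^T.
  by rewrite mulmxBr mulmxBl !trmx_mul !mulmxA.
rewrite BE IA ![(_ + _)^T]raddfD [(- _)^T]raddfN /= !trmx_mul !mulmxDl mulmxDr mulmxN.
by rewrite opprD !mulmxA -!addrA; congr (_ + _); rewrite addrCA.
Qed.

Section MatrixFields.
Context {R : realType} {V : normedModType R}.

Lemma derive_coord m n (F : V -> 'M[R]_(m, n)) v w i j :
  differentiable F v -> 'D_w (fun x => F x i j) v = ('D_w F v) i j.
Proof.
by move=> /differentiable_is_diff/(is_diff_coord i j)/is_diff_derive.
Qed.

Lemma differentiable_mx m n (F : V -> 'M[R]_(m, n)) v :
  (forall i j, differentiable (fun x => F x i j) v) -> differentiable F v.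
Proof.
move=> dF; apply: (@is_diff_differentiable _ _ _ _
  (fun w => \matrix_(i, j) 'D_w (fun x => F x i j) v)).
apply: is_diff_mx => i j.
apply: (is_diff_eq (differentiable_is_diff (dF i j))).
by apply/funext => w; rewrite mxE.
Qed.

Lemma derive_row m (W : normedModType R) (F : 'rV[R]_m -> W) t u :
  differentiable F t -> 'D_u F t = \sum_k u 0 k *: 'D_(delta_mx 0 k) F t.
Proof.
move=> dF; rewrite {1}(row_sum_delta u) (derive_sum _ _ _ dF).
by apply: eq_bigr => k _; rewrite !deriveE// linearZ.
Qed.

(** The equality to differentiate is known on [O] only; openness makes it hold near [v]. *)
Lemma derive_mx_sym m (O : set V) (F : V -> 'M[R]_m) v w :
  open O -> O v -> (forall x, O x -> (F x)^T = F x) -> differentiable F v ->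
  ('D_w F v)^T = 'D_w F v.
Proof.
move=> oO Ov FT dF.
have nF : \forall x \near v, (F x)^T = F x.
  by apply: filterS (open_nbhs_nbhs (conj oO Ov)) => x; exact: FT.
rewrite -[RHS](near_eq_derive w nF).
by rewrite (is_diff_derive _ (is_diff_trmx (differentiable_is_diff dF))).
Qed.

End MatrixFields.

Lemma derive_jacobian_trans_sym (R : realType) d (X : manifold R d)
    (a b : chart (matlas X)) t k j i : overlap a b t ->
  'D_(delta_mx 0 k) (jacobian (trans a b)) t j i =
  'D_(delta_mx 0 j) (jacobian (trans a b)) t k i.
Proof.
move=> abt; have dJ := is_diff_differentiable (is_diff_jacobian_trans abt).
apply: etrans (esym (derive_coord _ j i dJ)) (etrans _ (derive_coord _ k i dJ)).
exact: (jacobian_sym _ _ _ (@open_overlap _ _ _ a b) abt (mfd_trans_smooth a b)).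
Qed.

(** * Derivatives of the two metrics and their change of charts *)

Section MetricDerivatives.
Context {R : realType} {p n : nat} {T : manifold R p} {M : manifold R n}.

Lemma semiRiemannian_differentiable (h : semiRiemannian T) a t :
  img a t -> differentiable (h a) t.
Proof.
move=> at_; apply: differentiable_mx => i j.
exact: smooth_on_differentiable (hmx_smooth h a i j) at_.
Qed.

Lemma derive_semiRiemannian_sym (h : semiRiemannian T) a t u :
  img a t -> ('D_u (h a) t)^T = 'D_u (h a) t.
Proof.
move=> at_; apply: (derive_mx_sym _ (@open_img _ _ _ a) at_).
  exact: hmx_sym.
exact: semiRiemannian_differentiable.
Qed.

Lemma derive_semiRiemannian_change (h : semiRiemannian T) a b t u
    (J := jacobian (trans a b)) : overlap a b t ->
  'D_u (h a) t = 'D_u J t *m h b (trans a b t) *m (J t)^T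
    + J t *m 'D_(u *m J t) (h b) (trans a b t) *m (J t)^T
    + J t *m h b (trans a b t) *m ('D_u J t)^T.
Proof.
move=> abt; have bat := overlapC abt.
have nE : \forall x \near t, J x *m h b (trans a b x) *m (J x)^T = h a x.
  by apply: filterS (near_overlap abt) => x /(hmx_tensor h) ->.
rewrite -(near_eq_derive u nE).
have dJ := is_diff_jacobian_trans abt.
have dtr := trans_differentiable abt.
have dh := is_diff_comp (differentiable_is_diff dtr)
  (differentiable_is_diff (semiRiemannian_differentiable h (overlap_img bat))).
have H := is_diff_mulmx (is_diff_mulmx dJ dh) (is_diff_trmx dJ).
rewrite (is_diff_derive _ H) /= !mulmxDl.
by rewrite (deriveEjacobian _ dtr).
Qed.

Variable S : gml_space T M.

Lemma gml_differentiable c v : img c v -> differentiable (gml_g S c) v.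
Proof.
move=> cv; apply: differentiable_mx => i j.
exact: smooth_on_differentiable (gml_smooth S c i j) cv.
Qed.

Lemma gml_unit c v : img c v -> gml_g S c v \in unitmx.
Proof. by move=> cv; rewrite -row_free_unit /row_free (gml_rank S cv). Qed.

Lemma derive_gml_sym c v w :
  img c v -> ('D_w (gml_g S c) v)^T = 'D_w (gml_g S c) v.
Proof.
move=> cv; apply: (derive_mx_sym _ (@open_jet_img _ _ _ _ _ c) cv).
  exact: gml_sym.
exact: gml_differentiable.
Qed.

(** The product rule for g = K g' K^T. As [K] is a function of x, only the x-component of [w] enters
    [dK]; this later removes [dK] for the directions t and x^i_al. *)
Lemma derive_gml_change c c' v w (K := jacM c c' v)
    (dK := 'D_(w.1.2) (jacobian (trans c.2 c'.2)) v.1.2) : overlap c c' v ->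
  'D_w (gml_g S c) v = dK *m gml_g S c' (trans c c' v) *m K^T
    + K *m 'D_('D_w (trans c c') v) (gml_g S c') (trans c c' v) *m K^T
    + K *m gml_g S c' (trans c c' v) *m dK^T.
Proof.
move=> cv.
have nE : \forall x \near v, jacM c c' x *m gml_g S c' (trans c c' x)
    *m (jacM c c' x)^T = gml_g S c x.
  by apply: filterS (near_jet_overlap cv) => x /(gml_tensor S) ->.
rewrite -(near_eq_derive w nE).
have dJ := is_diff_jacM cv.
have dg := is_diff_comp (differentiable_is_diff (trans_jet_differentiable cv))
  (differentiable_is_diff (gml_differentiable (overlap_jet_img cv))).
have H := is_diff_mulmx (is_diff_mulmx dJ dg) (is_diff_trmx dJ).
by rewrite (is_diff_derive _ H) /= !mulmxDl.
Qed.

End MetricDerivatives.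

(** * Connection forms and their transformation laws *)

Section ConnectionForms.
Context {R : realType} {p n : nat} {T : manifold R p} {M : manifold R n}.
Notation V := (jcoord R p n).

Definition time_form (h : semiRiemannian T) a t (u : 'rV[R]_p) : 'M[R]_p :=
  \sum_ga u 0 ga *: koszul_mx (h a t) (fun k => 'D_(delta_mx 0 k) (h a) t) ga.

Lemma christoffelE (h : semiRiemannian T) a t ga al be : img a t ->
  christoffel h a t ga al be =
  koszul (h a t) (fun k => 'D_(delta_mx 0 k) (h a) t) ga al be.
Proof.
move=> at_; have dh := semiRiemannian_differentiable h at_.
apply: eq_bigr => et _; rewrite !derive_coord//; congr (_ * (_ - _)).
by rewrite addrC.
Qed.

Lemma time_formE (h : semiRiemannian T) a t u al be : img a t ->
  time_form h a t u al be = \sum_ga u 0 ga * christoffel h a t be al ga.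
Proof.
move=> at_; rewrite summxE; apply: eq_bigr => ga _.
by rewrite !mxE christoffelE.
Qed.

Lemma time_form_linear (h : semiRiemannian T) a t : linear (time_form h a t).
Proof.
move=> k x y; rewrite scaler_sumr -big_split; apply: eq_bigr => i _ /=.
by rewrite !mxE scalerDl scalerA.
Qed.

(** For coordinate directions this is [koszul_change] with [K] the Jacobian, whose derivative is
    symmetric by equality of mixed partials; both sides are then contracted with [u]. *)
Lemma time_form_change (h : semiRiemannian T) a b t u
    (J := jacobian (trans a b)) : overlap a b t ->
  time_form h a t u *m J t = 'D_u J t + J t *m time_form h b (trans a b t) (u *m J t).
Proof.
move=> abt; have bt := overlap_img (overlapC abt).
have dJ := is_diff_differentiable (is_diff_jacobian_trans abt).
have dtr := trans_differentiable abt.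
have dh := semiRiemannian_differentiable h bt.
have sym k j i := derive_jacobian_trans_sym k j i abt.
have dhE k : 'D_(delta_mx 0 k) (h a) t =
    'D_(delta_mx 0 k) J t *m h b (trans a b t) *m (J t)^T
    + J t *m (\sum_l J t k l *: 'D_(delta_mx 0 l) (h b) (trans a b t)) *m (J t)^T
    + J t *m h b (trans a b t) *m ('D_(delta_mx 0 k) J t)^T.
  rewrite (derive_semiRiemannian_change h _ abt); congr (_ + _ *m _ *m _ + _).
  rewrite -rowE (derive_row _ dh); by apply: eq_bigr => l _; rewrite mxE.
have H := koszul_change (hmx_unit h bt) (hmx_sym h bt)
  (fun l => derive_semiRiemannian_sym h _ bt) (jacobian_trans_unit abt)
  (hmx_tensor h abt) sym dhE.
rewrite /time_form mulmx_suml.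
under eq_bigr => k _ do rewrite -scalemxAl H.
under eq_bigr do rewrite scalerDr; rewrite big_split /= -(derive_row _ dJ).
congr (_ + _); under eq_bigr do rewrite scalemxAr.
rewrite -mulmx_sumr; congr (_ *m _).
exact/esym/sum_mulmx_scale.
Qed.

End ConnectionForms.

Lemma derive_lincomb (R : realType) (V W : normedModType R) (f : V -> W) v
    (I : finType) (a : I -> R) (E : I -> V) : differentiable f v ->
  'D_(\sum_i a i *: E i) f v = \sum_i a i *: 'D_(E i) f v.
Proof.
move=> df; rewrite (derive_sum _ _ _ df); apply: eq_bigr => i _.
by rewrite !deriveE// linearZ.
Qed.

Section MetricForm.
Context {R : realType} {p n : nat} {T : manifold R p} {M : manifold R n}.
Variables (S : gml_space T M) (Gam : nonlinear_connection T M).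
Notation V := (jcoord R p n).
Notation g := (gml_g S).
Implicit Types (c : jchart T M) (v w : V).

(** Linearity in the derivatives of the metric, needed for vertical directions: a change of charts
    replaces d/dx^k_ga by a combination over all time indices. *)
Lemma koszul_mx_sum (q : 'M[R]_n) (I : finType) (a : I -> R)
    (D : I -> 'I_n -> 'M[R]_n) k :
  koszul_mx q (fun l => \sum_i a i *: D i l) k = \sum_i a i *: koszul_mx q (D i) k.
Proof.
apply/matrixP => j i; rewrite mxE summxE.
under [RHS]eq_bigr do rewrite !mxE mulr_sumr.
rewrite exchange_big; apply: eq_bigr => m _; rewrite !summxE.
rewrite -big_split -sumrB mulr_sumr; apply: eq_bigr => l _ /=.
by rewrite !mxE; ring.
Qed.

(** The coefficient G of condition ii), transposed: row [j] is the lower index, so g^-1 stands on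
    the right. *)
Definition dt_form c v ga : 'M[R]_n :=
  2%:R^-1 *: ('D_(dt Gam c ga v) (g c) v *m invmx (g c v)).

Definition dx_form c v k : 'M[R]_n :=
  koszul_mx (g c v) (fun l => 'D_(dx Gam c l v) (g c) v) k.

Definition dy_form c v k ga : 'M[R]_n :=
  koszul_mx (g c v) (fun l => 'D_(dv l ga) (g c) v) k.

Definition metric_form c v w : 'M[R]_n :=
  \sum_ga w.1.1 0 ga *: dt_form c v ga + \sum_k w.1.2 0 k *: dx_form c v k
  + \sum_k \sum_ga w.2 k ga *: dy_form c v k ga.

Lemma metric_form_linear c v : linear (metric_form c v).
Proof.
move=> a x y; rewrite /metric_form /= !scalerDr !scaler_sumr.
rewrite [RHS]addrACA [X in _ = X + _]addrACA -!big_split /=.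
congr (_ + _ + _); apply: eq_bigr => k _.
- by rewrite !mxE scalerDl -scalerA.
- by rewrite !mxE scalerDl -scalerA.
rewrite scaler_sumr -big_split; apply: eq_bigr => ga _.
by rewrite !mxE scalerDl -scalerA.
Qed.

(** The law is homogeneous because delta/delta t^ga has no x-component, so the derivative of [K]
    along it is zero. *)
Lemma dt_form_change c c' v ga (K := jacM c c' v) : overlap c c' v ->
  dt_form c v ga *m K =
  K *m (\sum_be jacT c c' v ga be *: dt_form c' (trans c c' v) be).
Proof.
move=> cv; have cv' := overlap_jet_img cv.
have uK : K \in unitmx := jacM_unit cv.
have ug' := gml_unit S cv'.
have gE : g c v = K *m g c' (trans c c' v) *m K^T := gml_tensor S cv.
have gVK : invmx (g c v) *m K = invmx K^T *m invmx (g c' (trans c c' v)).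
  have uKT : K^T \in unitmx by rewrite unitmx_tr.
  have {1}-> : K = g c v *m (invmx K^T *m invmx (g c' (trans c c' v))).
    by rewrite gE -!mulmxA (mulKVmx uKT) (mulmxV ug') mulmx1.
  by rewrite (mulKmx (gml_unit S (overlap_jet_img1 cv))).
rewrite /dt_form -scalemxAl -mulmxA gVK (derive_gml_change S _ cv).
have -> : (dt Gam c ga v).1.2 = 0 by rewrite -of_adapted_t.
rewrite derive0 trmx0 !mul0mx mulmx0 addr0 add0r.
rewrite -2![K *m _ *m _]mulmxA.
have uKT : K^T \in unitmx by rewrite unitmx_tr.
set D := 'D_('D_(dt Gam c ga v) _ v) _ _.
have -> : D *m K^T *m (invmx K^T *m invmx (g c' (trans c c' v))) =
    D *m invmx (g c' (trans c c' v)) by rewrite -mulmxA (mulKVmx uKT).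
rewrite scalemxAr; congr (_ *m _); rewrite {}/D.
rewrite (nl_dt_tensor Gam cv) (derive_lincomb _ _ (gml_differentiable S cv')).
rewrite mulmx_suml scaler_sumr; apply: eq_bigr => be _.
by rewrite -scalemxAl !scalerA mulrC.
Qed.

Lemma dx_form_change c c' v k (K := jacM c c' v) : overlap c c' v ->
  dx_form c v k *m K =
  'D_(delta_mx 0 k) (jacobian (trans c.2 c'.2)) v.1.2
  + K *m (\sum_l K k l *: dx_form c' (trans c c' v) l).
Proof.
move=> cv; have cv' := overlap_jet_img cv.
have [_ xv] := (overlap_jetP c c' v).1 cv.
have dgE j : 'D_(dx Gam c j v) (g c) v =
    'D_(delta_mx 0 j) (jacobian (trans c.2 c'.2)) v.1.2
      *m g c' (trans c c' v) *m K^T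
    + K *m (\sum_l K j l *: 'D_(dx Gam c' l (trans c c' v)) (g c') (trans c c' v))
      *m K^T
    + K *m g c' (trans c c' v)
      *m ('D_(delta_mx 0 j) (jacobian (trans c.2 c'.2)) v.1.2)^T.
  rewrite (derive_gml_change S _ cv) (nl_dx_tensor Gam cv).
  rewrite (derive_lincomb _ _ (gml_differentiable S cv')).
  by have -> : (dx Gam c j v).1.2 = delta_mx 0 j by rewrite -of_adapted_x.
exact: (koszul_change (gml_unit S cv') (gml_sym S cv')
  (fun l => derive_gml_sym S _ cv') (jacM_unit cv) (gml_tensor S cv)
  (fun k j i => derive_jacobian_trans_sym k j i xv) dgE).
Qed.

(** [koszul_change] with zero [dK]. For fixed [ga] the factor J^-1 acts only on the time index, so
    the derivatives of the new metric are contracted with it first and expanded again by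
    [koszul_mx_sum]. *)
Lemma dy_form_change c c' v k ga (K := jacM c c' v) : overlap c c' v ->
  dy_form c v k ga *m K = K *m (\sum_l K k l *:
    \sum_be invmx (jacT c c' v) be ga *: dy_form c' (trans c c' v) l be).
Proof.
move=> cv; have cv' := overlap_jet_img cv.
pose dg' l := \sum_be invmx (jacT c c' v) be ga *:
  'D_(dv l be) (g c') (trans c c' v).
have dg'T l : (dg' l)^T = dg' l.
  rewrite /dg' linear_sum; apply: eq_bigr => be _.
  by rewrite linearZ /= (derive_gml_sym S _ cv').
have dgE j : 'D_(dv j ga) (g c) v = 0 *m g c' (trans c c' v) *m K^T
    + K *m (\sum_l K j l *: dg' l) *m K^T + K *m g c' (trans c c' v) *m 0^T.
  rewrite (derive_gml_change S _ cv) /= derive0; congr (_ + _ *m _ *m _ + _).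
  rewrite (derive_trans_y Gam _ _ cv).
  rewrite (derive_sum _ _ _ (gml_differentiable S cv')); apply: eq_bigr => l _.
  rewrite (derive_lincomb _ _ (gml_differentiable S cv')) scaler_sumr.
  by apply: eq_bigr => be _; rewrite scalerA.
have sym0 (a b d : 'I_n) : (fun=> 0 : 'M[R]_n) a b d = (fun=> 0 : 'M[R]_n) b a d.
  by rewrite !mxE.
rewrite /dy_form (koszul_change (gml_unit S cv') (gml_sym S cv') dg'T
  (jacM_unit cv) (gml_tensor S cv) sym0 dgE) add0r; congr (_ *m _).
by apply: eq_bigr => l _; rewrite koszul_mx_sum.
Qed.

Lemma metric_form_change c c' v w (K := jacM c c' v) : overlap c c' v ->
  metric_form c v w *m K = 'D_(w.1.2) (jacobian (trans c.2 c'.2)) v.1.2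
    + K *m metric_form c' (trans c c' v) (adapted_change c c' v w).
Proof.
move=> cv; have [_ xv] := (overlap_jetP c c' v).1 cv.
have dJ := is_diff_differentiable (is_diff_jacobian_trans xv).
have Et : (\sum_ga w.1.1 0 ga *: dt_form c v ga) *m K = K *m (\sum_ga
    (adapted_change c c' v w).1.1 0 ga *: dt_form c' (trans c c' v) ga).
  rewrite [X in K *m X]sum_mulmx_scale mulmx_suml mulmx_sumr.
  by apply: eq_bigr => ga _; rewrite -scalemxAl -scalemxAr (dt_form_change ga cv).
have Ex : (\sum_k w.1.2 0 k *: dx_form c v k) *m K =
    'D_(w.1.2) (jacobian (trans c.2 c'.2)) v.1.2 + K *m (\sum_k
    (adapted_change c c' v w).1.2 0 k *: dx_form c' (trans c c' v) k).
  rewrite (derive_row _ dJ) [X in K *m X]sum_mulmx_scale mulmx_suml mulmx_sumr.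
  rewrite -big_split; apply: eq_bigr => k _ /=.
  by rewrite -scalemxAl -scalemxAr (dx_form_change k cv) scalerDr.
have Ey : (\sum_k \sum_ga w.2 k ga *: dy_form c v k ga) *m K =
    K *m (\sum_k \sum_ga
      (adapted_change c c' v w).2 k ga *: dy_form c' (trans c c' v) k ga).
  rewrite [X in K *m X]sum_mulmx_scale2 mulmx_suml mulmx_sumr.
  apply: eq_bigr => k _; rewrite mulmx_suml mulmx_sumr; apply: eq_bigr => ga _.
  by rewrite -scalemxAl -scalemxAr (dy_form_change k ga cv).
rewrite /metric_form 2!mulmxDl 2![in RHS]mulmxDr Et Ex Ey !addrA.
by congr (_ + _ + _); rewrite addrC.
Qed.

End MetricForm.

(** * The Cartan connection *)

Section SmoothFields.
Context {R : realType} {p n : nat}.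
Notation V := (jcoord R p n).

(** Smoothness is defined through constant directions; a variable direction is expanded in the
    coordinate basis with smooth coefficients. *)
Lemma smooth_on_derive_along (W : normedModType R) (O : set V) (F : V -> W)
    (Y : V -> V) : open O -> smooth_on O F -> smooth_on O Y ->
  smooth_on O (fun v => 'D_(Y v) F v).
Proof.
move=> oO sF sY.
have s1 := smooth_on_fst oO (smooth_on_fst oO sY).
have s2 := smooth_on_snd oO (smooth_on_fst oO sY).
have s3 := smooth_on_snd oO sY.
have st al := smooth_onZ oO (smooth_on_coord 0 al oO s1)
  (smooth_on_derive (e_t R n al) sF).
have sx i := smooth_onZ oO (smooth_on_coord 0 i oO s2)
  (smooth_on_derive (e_x R p i) sF).
have sy i al := smooth_onZ oO (smooth_on_coord i al oO s3)
  (smooth_on_derive (dv i al) sF).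
have S1 := smooth_on_sum (index_enum _) (P := xpredT) oO (fun al _ => st al).
have S2 := smooth_on_sum (index_enum _) (P := xpredT) oO (fun i _ => sx i).
have S3 := smooth_on_sum (index_enum _) (P := xpredT) oO (fun i _ =>
  smooth_on_sum (index_enum _) (P := xpredT) oO (fun al _ => sy i al)).
apply: smooth_on_eq (smooth_onD oO (smooth_onD oO S1 S2) S3) => // v Ov.
have dF := smooth_on_differentiable sF Ov.
rewrite [in RHS](jcoord_basis (Y v)) !deriveE// !linearD !linear_sum /=.
congr (_ + _ + _); apply: eq_bigr => i _; rewrite ?linearZ ?deriveE//.
by rewrite linear_sum; apply: eq_bigr => al _; rewrite linearZ ?deriveE.
Qed.

Lemma smooth_on_koszul (V' : normedModType R) m (O : set V') (q : V' -> 'M[R]_m)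
    (dq : 'I_m -> V' -> 'M[R]_m) k : open O ->
    (forall i j, smooth_on O (fun v => q v i j)) ->
    (forall v, O v -> q v \in unitmx) -> (forall l, smooth_on O (dq l)) ->
  smooth_on O (fun v => koszul_mx (q v) (fun l => dq l v) k).
Proof.
move=> oO sq uq sdq; apply: smooth_on_mx => // j i.
rewrite (_ : (fun v => _) = fun v => koszul (q v) (fun l => dq l v) i j k); last first.
  by apply/funext => v; rewrite mxE.
apply: smooth_on_sum => // l _.
apply: smooth_onM => //.
  apply: smooth_onM => //; first exact: smooth_on_invmx.
  exact: smooth_on_cst.
apply: smooth_onB => //; first apply: smooth_onD => //;
  by apply: smooth_on_coord.
Qed.

End SmoothFields.

Section AdaptedFields.
Context {R : realType} {p n : nat} {T : manifold R p} {M : manifold R n}.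
Variable Gam : nonlinear_connection T M.
Notation V := (jcoord R p n).
Implicit Types (c : jchart T M) (v w : V).

Section OnOpen.
Variables (c : jchart T M) (O : set V).
Hypotheses (oO : open O) (Oc : O `<=` img c).

Lemma smooth_on_horizontal (Z : V -> V) : smooth_on O Z ->
  smooth_on O (fun v => horizontal_part Gam c v (Z v)).
Proof.
move=> sZ; apply: smooth_on_mx => // j be.
rewrite (_ : (fun v => _) = fun v =>
    \sum_al (Z v).1.1 0 al * nlM Gam c v j be al
    + \sum_i (Z v).1.2 0 i * nlN Gam c v j be i); last first.
  by apply/funext => v; rewrite mxE.
have s1 := smooth_on_fst oO (smooth_on_fst oO sZ).
have s2 := smooth_on_snd oO (smooth_on_fst oO sZ).
apply: smooth_onD => //; apply: smooth_on_sum => // k _; apply: smooth_onM => //.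
- exact: smooth_on_coord.
- exact: smooth_on_sub (nlM_smooth Gam c j be k).
- exact: smooth_on_coord.
- exact: smooth_on_sub (nlN_smooth Gam c j be k).
Qed.

Lemma smooth_on_to_adapted (Z : V -> V) : smooth_on O Z ->
  smooth_on O (fun v => to_adapted Gam c v (Z v)).
Proof.
move=> sZ.
have s1 := smooth_on_fst oO (smooth_on_fst oO sZ).
have s2 := smooth_on_snd oO (smooth_on_fst oO sZ).
have s3 := smooth_onD oO (smooth_on_snd oO sZ) (smooth_on_horizontal sZ).
exact: (smooth_on_pair oO (smooth_on_pair oO s1 s2) s3).
Qed.

Lemma smooth_on_of_adapted (Z : V -> V) : smooth_on O Z ->
  smooth_on O (fun v => of_adapted Gam c v (Z v)).
Proof.
move=> sZ.
have s1 := smooth_on_fst oO (smooth_on_fst oO sZ).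
have s2 := smooth_on_snd oO (smooth_on_fst oO sZ).
have s3 := smooth_onB oO (smooth_on_snd oO sZ) (smooth_on_horizontal sZ).
exact: (smooth_on_pair oO (smooth_on_pair oO s1 s2) s3).
Qed.

Lemma smooth_on_dt al : smooth_on O (dt Gam c al).
Proof.
apply: smooth_on_eq (smooth_on_of_adapted (smooth_on_cst O (e_t R n al))) => // v _.
exact: of_adapted_t.
Qed.

Lemma smooth_on_dx i : smooth_on O (dx Gam c i).
Proof.
apply: smooth_on_eq (smooth_on_of_adapted (smooth_on_cst O (e_x R p i))) => // v _.
exact: of_adapted_x.
Qed.

End OnOpen.

End AdaptedFields.

Section CartanConnection.
Context {R : realType} {p n : nat} {T : manifold R p} {M : manifold R n}.
Variables (S : gml_space T M) (Gam : nonlinear_connection T M).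
Notation V := (jcoord R p n).
Notation g := (gml_g S).
Notation h := (gml_h S).
Implicit Types (c : jchart T M) (v w u : V).

(** The two forms act on upper indices by right multiplication. In the vertical block i is an upper
    index and al a lower one, whence the transposes and the minus sign before the Christoffel
    part. *)
Definition cartan_form c v u w : V :=
  (w.1.1 *m time_form h c.1 v.1.1 u.1.1, w.1.2 *m metric_form S Gam c v u,
   (metric_form S Gam c v u)^T *m w.2
     - w.2 *m (time_form h c.1 v.1.1 u.1.1)^T).

Definition cartan_nabla c (Y Z : V -> V) v : V :=
  of_adapted Gam c v ('D_(Y v) (fun x => to_adapted Gam c x (Z x)) v
    + cartan_form c v (to_adapted Gam c v (Y v)) (to_adapted Gam c v (Z v))).

Lemma cartan_form_linearl c v w : linear (cartan_form c v ^~ w).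
Proof.
move=> a x y; rewrite /cartan_form /= time_form_linear metric_form_linear.
apply: injective_projections; [apply: injective_projections|]; rewrite /=.
- by rewrite mulmxDr -scalemxAr.
- by rewrite mulmxDr -scalemxAr.
rewrite ![(_ *: _ + _)^T]linearP /= mulmxDl mulmxDr -scalemxAl -scalemxAr.
by rewrite scalerBr opprD addrACA.
Qed.

Lemma cartan_form_linearr c v u : linear (cartan_form c v u).
Proof.
move=> a x y; rewrite /cartan_form /=.
apply: injective_projections; [apply: injective_projections|]; rewrite /=.
- by rewrite mulmxDl -scalemxAl.
- by rewrite mulmxDl -scalemxAl.
rewrite mulmxDl mulmxDr -scalemxAl -scalemxAr.
by rewrite scalerBr opprD addrACA.
Qed.

Lemma smooth_on_gml c (O : set V) : open O -> O `<=` img c ->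
  smooth_on O (g c).
Proof.
move=> oO Oc; apply: smooth_on_mx => // i j.
exact: smooth_on_sub (gml_smooth S c i j).
Qed.

Lemma smooth_on_cartan_form c (O : set V) (u w : V -> V) :
    open O -> O `<=` img c -> smooth_on O u -> smooth_on O w ->
  smooth_on O (fun v => cartan_form c v (u v) (w v)).
Proof.
move=> oO Oc su sw.
have u1 := smooth_on_fst oO (smooth_on_fst oO su).
have u2 := smooth_on_snd oO (smooth_on_fst oO su).
have u3 := smooth_on_snd oO su.
have w1 := smooth_on_fst oO (smooth_on_fst oO sw).
have w2 := smooth_on_snd oO (smooth_on_fst oO sw).
have w3 := smooth_on_snd oO sw.
have sg := smooth_on_gml oO Oc.
have sgij i j := smooth_on_coord i j oO sg.
have ug v (Ov : O v) := gml_unit S (Oc v Ov).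
have sT : smooth_on O (fun v => time_form h c.1 v.1.1 (u v).1.1).
  apply: smooth_on_sum => // ga _; apply: smooth_onZ => //.
    exact: smooth_on_coord.
  have sk : smooth_on (img c.1) (fun t => koszul_mx (h c.1 t)
      (fun k => 'D_(delta_mx 0 k) (h c.1) t) ga).
    have oc := @open_img _ _ _ c.1.
    apply: smooth_on_koszul => [//|i j|t|l].
    - exact: hmx_smooth.
    - exact: hmx_unit.
    apply: smooth_on_derive; apply: smooth_on_mx => // i j.
    exact: hmx_smooth.
  pose L : {linear V -> 'rV[R]_p} := fst \o fst.
  apply: (smooth_on_comp_lin (L := L) _ oO _ sk) => v.
    by apply: continuous_comp; exact: fst_continuous.
  by move=> /Oc/img_jetP[].
have sM : smooth_on O (fun v => metric_form S Gam c v (u v)).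
  apply: smooth_onD => //; first apply: smooth_onD => //.
  - apply: smooth_on_sum => // ga _; apply: smooth_onZ => //.
      exact: smooth_on_coord.
    apply: smooth_onZ => //; first exact: smooth_on_cst.
    apply: smooth_on_mulmx => //.
      by apply: smooth_on_derive_along => //; exact: smooth_on_dt.
    by apply: smooth_on_mx => // i j; exact: smooth_on_invmx.
  - apply: smooth_on_sum => // k _; apply: smooth_onZ => //.
      exact: smooth_on_coord.
    apply: smooth_on_koszul => // l.
    by apply: smooth_on_derive_along => //; exact: smooth_on_dx.
  apply: smooth_on_sum => // k _; apply: smooth_on_sum => // ga _.
  apply: smooth_onZ => //; first exact: smooth_on_coord.
  by apply: smooth_on_koszul => // l; exact: smooth_on_derive.
have sMT := smooth_on_trmx oO sM; have sTT := smooth_on_trmx oO sT.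
exact: (smooth_on_pair oO (smooth_on_pair oO (smooth_on_mulmx oO w1 sT)
  (smooth_on_mulmx oO w2 sM)) (smooth_onB oO (smooth_on_mulmx oO sMT w3)
  (smooth_on_mulmx oO w3 sTT))).
Qed.

Lemma cartan_nabla_smooth c (O : set V) (Y Z : V -> V) :
  open O -> O `<=` img c -> smooth_on O Y -> smooth_on O Z ->
  smooth_on O (cartan_nabla c Y Z).
Proof.
move=> oO Oc sY sZ.
have sY' := smooth_on_to_adapted Gam oO Oc sY.
have sZ' := smooth_on_to_adapted Gam oO Oc sZ.
apply: (smooth_on_of_adapted Gam oO Oc); apply: smooth_onD => //.
  exact: smooth_on_derive_along.
exact: smooth_on_cartan_form.
Qed.

Lemma to_adapted_differentiable c (Z : V -> V) v :
  img c v -> differentiable Z v ->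
  differentiable (fun x => to_adapted Gam c x (Z x)) v.
Proof.
move=> cv /differentiable_is_diff dZ.
have d1 := is_diff_fst (is_diff_fst dZ).
have d2 := is_diff_snd (is_diff_fst dZ).
have dH : differentiable (fun x => horizontal_part Gam c x (Z x)) v.
  apply: differentiable_mx => j be.
  rewrite (_ : (fun x => _) = fun x =>
      \sum_al (Z x).1.1 0 al * nlM Gam c x j be al
      + \sum_i (Z x).1.2 0 i * nlN Gam c x j be i); last first.
    by apply/funext => x; rewrite mxE.
  have dM al := differentiable_is_diff
    (smooth_on_differentiable (nlM_smooth Gam c j be al) cv).
  have dN i := differentiable_is_diff
    (smooth_on_differentiable (nlN_smooth Gam c j be i) cv).
  have S1 := is_diff_sum (index_enum _) (P := xpredT)
    (fun al _ => is_diff_mul (is_diff_coord 0 al d1) (dM al)).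
  have S2 := is_diff_sum (index_enum _) (P := xpredT)
    (fun i _ => is_diff_mul (is_diff_coord 0 i d2) (dN i)).
  exact: is_diff_differentiable (is_diff_add S1 S2).
have d3 := is_diff_add (is_diff_snd dZ) (differentiable_is_diff dH).
exact: is_diff_differentiable (is_diff_pair (is_diff_pair d1 d2) d3).
Qed.

Lemma cartan_nabla_local c (O : set V) (Y Y' Z Z' : V -> V) :
  open O -> O `<=` img c -> smooth_on O Y -> smooth_on O Z ->
  {in O, Y =1 Y'} -> {in O, Z =1 Z'} ->
  {in O, cartan_nabla c Y Z =1 cartan_nabla c Y' Z'}.
Proof.
move=> oO Oc _ _ YY' ZZ' v vO; have Ov := set_mem vO.
rewrite /cartan_nabla (YY' v vO) (ZZ' v vO).
have nE : \forall x \near v, to_adapted Gam c x (Z x) = to_adapted Gam c x (Z' x).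
  by apply: filterS (open_nbhs_nbhs (conj oO Ov)) => x Ox; rewrite ZZ'// inE.
by rewrite (near_eq_derive _ nE).
Qed.

Lemma cartan_nabla_addl c (O : set V) (Y Y' Z : V -> V) :
  open O -> O `<=` img c -> smooth_on O Y -> smooth_on O Y' -> smooth_on O Z ->
  {in O, cartan_nabla c (Y + Y') Z =1 cartan_nabla c Y Z + cartan_nabla c Y' Z}.
Proof.
move=> oO Oc _ _ sZ v /set_mem Ov; rewrite /cartan_nabla !fctE.
have dZ := to_adapted_differentiable (Oc v Ov) (smooth_on_differentiable sZ Ov).
rewrite -[RHS]linearD; congr (of_adapted _ _ _ _).
rewrite !(deriveE _ dZ) !linearD /= -[X in cartan_form _ _ (X + _) _]scale1r.
rewrite cartan_form_linearl.
by rewrite scale1r addrACA.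
Qed.

Lemma cartan_nabla_scalel c (O : set V) (f : V -> R) (Y Z : V -> V) :
  open O -> O `<=` img c -> smooth_on O f -> smooth_on O Y -> smooth_on O Z ->
  {in O, cartan_nabla c (fun v => f v *: Y v) Z =1
         fun v => f v *: cartan_nabla c Y Z v}.
Proof.
move=> oO Oc _ _ sZ v /set_mem Ov; rewrite /cartan_nabla.
have dZ := to_adapted_differentiable (Oc v Ov) (smooth_on_differentiable sZ Ov).
rewrite -[RHS]linearZ; congr (of_adapted _ _ _ _).
rewrite !(deriveE _ dZ) !linearZ /= scalerDr; congr (_ + _).
pose L := GRing.isLinear.Build R V V _ _
  (cartan_form_linearl c v (to_adapted Gam c v (Z v))).
pose F : {linear V -> V} := HB.pack (cartan_form c v ^~ (to_adapted Gam c v (Z v))) L.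
exact: (linearZ_LR F).
Qed.

Lemma cartan_nabla_addr c (O : set V) (Y Z Z' : V -> V) :
  open O -> O `<=` img c -> smooth_on O Y -> smooth_on O Z -> smooth_on O Z' ->
  {in O, cartan_nabla c Y (Z + Z') =1 cartan_nabla c Y Z + cartan_nabla c Y Z'}.
Proof.
move=> oO Oc _ sZ sZ' v /set_mem Ov; rewrite /cartan_nabla !fctE.
have dZ := differentiable_is_diff (to_adapted_differentiable (Oc v Ov)
  (smooth_on_differentiable sZ Ov)).
have dZ' := differentiable_is_diff (to_adapted_differentiable (Oc v Ov)
  (smooth_on_differentiable sZ' Ov)).
rewrite -linearD; congr (of_adapted _ _ _ _).
rewrite (_ : (fun x => _) = (fun x => to_adapted Gam c x (Z x)) +
    (fun x => to_adapted Gam c x (Z' x))); last first.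
  by apply/funext => x; rewrite !fctE linearD.
rewrite (is_diff_derive _ (is_diffD dZ dZ')) !fctE.
rewrite linearD /= -[X in cartan_form _ _ _ (X + _)]scale1r cartan_form_linearr.
by rewrite scale1r addrACA.
Qed.

Lemma cartan_nabla_leibniz c (O : set V) (f : V -> R) (Y Z : V -> V) :
  open O -> O `<=` img c -> smooth_on O f -> smooth_on O Y -> smooth_on O Z ->
  {in O, cartan_nabla c Y (fun v => f v *: Z v) =1
         fun v => 'D_(Y v) f v *: Z v + f v *: cartan_nabla c Y Z v}.
Proof.
move=> oO Oc sf _ sZ v /set_mem Ov; rewrite /cartan_nabla.
have dZ := differentiable_is_diff (to_adapted_differentiable (Oc v Ov)
  (smooth_on_differentiable sZ Ov)).
have df := differentiable_is_diff (smooth_on_differentiable sf Ov).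
rewrite -{2}(to_adaptedK Gam c v (Z v)) -!linearZ -linearD.
congr (of_adapted _ _ _ _).
rewrite (_ : (fun x => _) = fun x => f x *: to_adapted Gam c x (Z x)); last first.
  by apply/funext => x; rewrite linearZ.
rewrite (is_diff_derive _ (is_diff_scale df dZ)) scalerDr -addrA; congr (_ + (_ + _)).
  by rewrite linearZ.
pose L := GRing.isLinear.Build R V V _ _
  (cartan_form_linearr c v (to_adapted Gam c v (Y v))).
pose F : {linear V -> V} := HB.pack (cartan_form c v (to_adapted Gam c v (Y v))) L.
by rewrite linearZ; exact: (linearZ_LR F).
Qed.

(** The middle summand is the derivative along [u] of the coefficients of [adapted_change], applied
    to [w]. The product rule yields the same term in [cartan_nabla_change]. *)
Lemma cartan_form_change c c' v u w
    (du : V) : overlap c c' v ->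
  adapted_change c c' v (du + cartan_form c v u w) =
  adapted_change c c' v du
    + (w.1.1 *m 'D_(u.1.1) (jacobian (trans c.1 c'.1)) v.1.1,
       w.1.2 *m 'D_(u.1.2) (jacobian (trans c.2 c'.2)) v.1.2,
       ('D_(u.1.2) (jacobian (trans c.2 c'.2)) v.1.2)^T *m w.2
         *m (invmx (jacT c c' v))^T
       + (jacM c c' v)^T *m w.2 *m (- (invmx (jacT c c' v)
         *m 'D_(u.1.1) (jacobian (trans c.1 c'.1)) v.1.1
         *m invmx (jacT c c' v)))^T)
    + cartan_form c' (trans c c' v) (adapted_change c c' v u)
        (adapted_change c c' v w).
Proof.
move=> cv; have [tv xv] := (overlap_jetP c c' v).1 cv.
rewrite linearD -addrA; congr (_ + _).
have trv : (trans c c' v).1.1 = trans c.1 c'.1 v.1.1.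
  by have [_ _ ->] := trans_jet cv.
have ET := time_form_change h u.1.1 tv.
have EM := metric_form_change S Gam u cv.
rewrite /cartan_form {1}/adapted_change /= trv -/(jacT c c' v).
rewrite -/(jacT c c' v) in ET.
set A := time_form _ _ _ _ in ET *; set A' := time_form _ _ _ _ in ET *.
set B := metric_form _ _ _ _ _ in EM *; set B' := metric_form _ _ _ _ _ in EM *.
set dJ := 'D_(u.1.1) _ _ in ET *; set dK := 'D_(u.1.2) _ _ in EM *.
have uJ := jacT_unit cv; have uK := jacM_unit cv.
move: uJ uK ET EM; set J := jacT c c' v; set K := jacM c c' v => uJ uK ET EM.
apply: injective_projections; [apply: injective_projections|]; rewrite /=.
- by rewrite -!mulmxA -mulmxDr ET.
- by rewrite -!mulmxA -mulmxDr EM.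
exact: vertical_form_change.
Qed.

Lemma cartan_nabla_change c c' (O : set V) (Y Y' Z Z' : V -> V) :
  open O -> O `<=` overlap c c' -> smooth_on O Y -> smooth_on O Z ->
  pushed c c' O Y Y' -> pushed c c' O Z Z' ->
  forall v, O v ->
    cartan_nabla c' Y' Z' (trans c c' v) =
    'D_(cartan_nabla c Y Z v) (trans c c') v.
Proof.
move=> oO Oc sY sZ [sY' YY'] [sZ' ZZ'] v Ov.
have cv := Oc v Ov; have cv' := overlap_jet_img cv.
have Oimg : O `<=` img c by move=> x /Oc/overlap_jet_img1.
(* In adapted components, being pushed forward means being related by [adapted_change]. *)
have pushE X X' : (forall v, O v -> X' (trans c c' v) = 'D_(X v) (trans c c') v) ->
    forall x, O x -> to_adapted Gam c' (trans c c' x) (X' (trans c c' x)) =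
      adapted_change c c' x (to_adapted Gam c x (X x)).
  move=> XX' x Ox; rewrite XX'// -{1}(to_adaptedK Gam c x (X x)).
  by rewrite (derive_trans_adapted Gam _ (Oc x Ox)) of_adaptedK.
rewrite /cartan_nabla (derive_trans_adapted Gam _ cv); congr (of_adapted _ _ _ _).
rewrite !(pushE _ _ YY' v Ov) !(pushE _ _ ZZ' v Ov) (cartan_form_change _ _ _ cv).
congr (_ + _).
have dtr := trans_jet_differentiable cv.
have dZ := differentiable_is_diff (to_adapted_differentiable (Oimg v Ov)
  (smooth_on_differentiable sZ Ov)).
have dZ' : differentiable (fun x => to_adapted Gam c' x (Z' x)) (trans c c' v).
  apply: to_adapted_differentiable cv' _; apply: smooth_on_differentiable sZ' _.
  by exists v.
have nE : \forall x \near v, adapted_change c c' x (to_adapted Gam c x (Z x)) =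
    ((fun x => to_adapted Gam c' x (Z' x)) \o trans c c') x.
  by apply: filterS (open_nbhs_nbhs (conj oO Ov)) => x /(pushE _ _ ZZ') <-.
rewrite (YY' v Ov) -(derive_comp (Y v) dtr dZ') -(near_eq_derive (Y v) nE).
have dJ := is_diff_jacT cv; have dK := is_diff_jacM cv.
have dI := is_diff_invmx_jacT cv.
have d1 := is_diff_mulmx (is_diff_fst (is_diff_fst dZ)) dJ.
have d2 := is_diff_mulmx (is_diff_snd (is_diff_fst dZ)) dK.
have d3 := is_diff_mulmx (is_diff_mulmx (is_diff_trmx dK) (is_diff_snd dZ))
  (is_diff_trmx dI).
rewrite (is_diff_derive (Y v) (is_diff_pair (is_diff_pair d1 d2) d3)) /=.
apply: injective_projections; [apply: injective_projections|]; rewrite /=.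
(* The derivatives of [J] and [K] see only the t and x components of [Y v], and [to_adapted] leaves
   these unchanged, so the two sides are convertible. *)
- exact: erefl.
- exact: erefl.
by rewrite [(_ + _) *m (invmx _)^T]mulmxDl [X in X + _]addrC -addrA.
Qed.

Definition cartan_linear_connection : linear_connection (jet_atlas T M) :=
  @LinearConnection R V (jet1 T M) (jet_atlas T M) cartan_nabla
    cartan_nabla_smooth cartan_nabla_local cartan_nabla_addl
    cartan_nabla_scalel cartan_nabla_addr cartan_nabla_leibniz
    cartan_nabla_change.

(** Frame fields have constant adapted components, so the derivative term vanishes and only the form
    remains. Each of the nine formulas of an h-normal connection is an instance. *)
Lemma cartan_nabla_adapted c (Y Z : V -> V) (u w : V) v :
  (forall x, Y x = of_adapted Gam c x u) -> (forall x, Z x = of_adapted Gam c x w) ->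
  cartan_nabla c Y Z v = of_adapted Gam c v (cartan_form c v u w).
Proof.
move=> YE ZE; rewrite /cartan_nabla.
rewrite (_ : (fun x => to_adapted Gam c x (Z x)) = cst w); last first.
  by apply/funext => x; rewrite ZE of_adaptedK.
by rewrite derive_cst add0r YE ZE !of_adaptedK.
Qed.

Lemma metric_form_t c v ga :
  metric_form S Gam c v (e_t R n ga) = dt_form S Gam c v ga.
Proof.
rewrite /metric_form /= [X in _ + _ + X]big1 ?addr0 => [|k _]; last first.
  by apply: big1 => al _; rewrite mxE scale0r.
rewrite [X in _ + X]big1 ?addr0 => [|k _]; last by rewrite mxE scale0r.
rewrite (bigD1 ga)//= big1 ?addr0; first by rewrite mxE !eqxx scale1r.
by move=> k kga; rewrite mxE (negbTE kga) andbF scale0r.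
Qed.

Lemma metric_form_x c v k :
  metric_form S Gam c v (e_x R p k) = dx_form S Gam c v k.
Proof.
rewrite /metric_form /= [X in _ + _ + X]big1 ?addr0 => [|l _]; last first.
  by apply: big1 => al _; rewrite mxE scale0r.
rewrite [X in X + _]big1 ?add0r => [|l _]; last by rewrite mxE scale0r.
rewrite (bigD1 k)//= big1 ?addr0; first by rewrite mxE !eqxx scale1r.
by move=> l lk; rewrite mxE (negbTE lk) andbF scale0r.
Qed.

Lemma metric_form_y c v k ga :
  metric_form S Gam c v (dv k ga) = dy_form S c v k ga.
Proof.
rewrite /metric_form /= [X in X + _ + _]big1 ?add0r => [|l _]; last first.
  by rewrite mxE scale0r.
rewrite [X in X + _]big1 ?add0r => [|l _]; last by rewrite mxE scale0r.
rewrite (bigD1 k)//= [X in _ + X]big1 ?addr0; last first.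
  by move=> l lk; apply: big1 => al _; rewrite mxE (negbTE lk) scale0r.
rewrite (bigD1 ga)//= big1 ?addr0; first by rewrite mxE !eqxx scale1r.
by move=> l lga; rewrite mxE (negbTE lga) andbF scale0r.
Qed.

Lemma time_form0 a t : time_form h a t 0 = 0.
Proof. by apply: big1 => k _; rewrite mxE scale0r. Qed.

Lemma time_form_delta a t ga al be : img a t ->
  time_form h a t (delta_mx 0 ga) al be = christoffel h a t be al ga.
Proof.
move=> at_; rewrite time_formE// (bigD1 ga)//= big1 ?addr0.
  by rewrite mxE !eqxx mul1r.
by move=> k kga; rewrite mxE (negbTE kga) andbF mul0r.
Qed.

Lemma cartan_form_t c v u al :
  cartan_form c v u (e_t R n al) =
  \sum_be time_form h c.1 v.1.1 u.1.1 al be *: e_t R n be.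
Proof.
rewrite sum_e_t /cartan_form /= -rowE mul0mx mulmx0 mul0mx subr0.
by congr (_, _, _); apply/rowP => i; rewrite !mxE.
Qed.

Lemma cartan_form_x c v u j :
  cartan_form c v u (e_x R p j) =
  \sum_i metric_form S Gam c v u j i *: e_x R p i.
Proof.
rewrite sum_e_x /cartan_form /= -rowE mul0mx mulmx0 mul0mx subr0.
by congr (_, _, _); apply/rowP => i; rewrite !mxE.
Qed.

Lemma cartan_form_y c v u i al :
  cartan_form c v u (dv i al) =
  \sum_k metric_form S Gam c v u i k *: dv k al
  - \sum_et time_form h c.1 v.1.1 u.1.1 et al *: dv i et.
Proof.
rewrite /cartan_form /= !mul0mx.
apply: injective_projections; [apply: injective_projections|]; rewrite /=.
- by rewrite !raddf_sum /= !big1 ?oppr0 ?addr0// => k _; rewrite ?scaler0 ?oppr0.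
- by rewrite !raddf_sum /= !big1 ?oppr0 ?addr0// => k _; rewrite ?scaler0 ?oppr0.
congr (_ - _); rewrite [RHS]raddf_sum.
  apply/matrixP => k be; rewrite mxE summxE (bigD1 i)//= big1 ?addr0 => [|l li].
    rewrite (bigD1 k)//= big1 ?addr0 => [|l lk].
      by rewrite !mxE !eqxx.
    by rewrite !mxE eq_sym (negbTE lk) mulr0.
  by rewrite !mxE (negbTE li) mulr0.
apply/matrixP => k be; rewrite mxE summxE (bigD1 al)//= big1 ?addr0 => [|l lal].
  rewrite (bigD1 be)//= big1 ?addr0 => [|l lk].
    by rewrite !mxE !eqxx andbT mulrC.
  by rewrite !mxE [be == l]eq_sym (negbTE lk) andbF mulr0.
by rewrite !mxE (negbTE lal) andbF mul0r.
Qed.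

Lemma cartan_tt c v : img c v -> forall ga al,
  cartan_nabla c (dt Gam c ga) (dt Gam c al) v =
  \sum_(be < p) christoffel h c.1 v.1.1 be al ga *: dt Gam c be v.
Proof.
move=> /img_jetP[cv _] ga al.
rewrite (@cartan_nabla_adapted c _ _ (e_t R n ga) (e_t R n al)); last 2 first.
- by move=> x; rewrite of_adapted_t.
- by move=> x; rewrite of_adapted_t.
rewrite cartan_form_t linear_sum; apply: eq_bigr => be _.
by rewrite linearZ /= of_adapted_t time_form_delta.
Qed.

Lemma cartan_xt c v k al : cartan_nabla c (dx Gam c k) (dt Gam c al) v = 0.
Proof.
rewrite (@cartan_nabla_adapted c _ _ (e_x R p k) (e_t R n al)); last 2 first.
- by move=> x; rewrite of_adapted_x.
- by move=> x; rewrite of_adapted_t.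
rewrite cartan_form_t /= time_form0 big1 ?linear0// => be _.
by rewrite mxE scale0r.
Qed.

Lemma cartan_yt c v k ga al : cartan_nabla c (dy k ga) (dt Gam c al) v = 0.
Proof.
rewrite (@cartan_nabla_adapted c _ _ (dv k ga) (e_t R n al)); last 2 first.
- by move=> x; rewrite of_adapted_y.
- by move=> x; rewrite of_adapted_t.
rewrite cartan_form_t /= time_form0 big1 ?linear0// => be _.
by rewrite mxE scale0r.
Qed.

Lemma cartan_tx c v ga j : cartan_nabla c (dt Gam c ga) (dx Gam c j) v =
  \sum_(k < n) dt_form S Gam c v ga j k *: dx Gam c k v.
Proof.
rewrite (@cartan_nabla_adapted c _ _ (e_t R n ga) (e_x R p j)); last 2 first.
- by move=> x; rewrite of_adapted_t.
- by move=> x; rewrite of_adapted_x.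
rewrite cartan_form_x linear_sum; apply: eq_bigr => k _.
by rewrite linearZ /= of_adapted_x metric_form_t.
Qed.

Lemma cartan_xx c v k j : cartan_nabla c (dx Gam c k) (dx Gam c j) v =
  \sum_(i < n) dx_form S Gam c v k j i *: dx Gam c i v.
Proof.
rewrite (@cartan_nabla_adapted c _ _ (e_x R p k) (e_x R p j)); last 2 first.
- by move=> x; rewrite of_adapted_x.
- by move=> x; rewrite of_adapted_x.
rewrite cartan_form_x linear_sum; apply: eq_bigr => i _.
by rewrite linearZ /= of_adapted_x metric_form_x.
Qed.

Lemma cartan_yx c v k ga j : cartan_nabla c (dy k ga) (dx Gam c j) v =
  \sum_(i < n) dy_form S c v k ga j i *: dx Gam c i v.
Proof.
rewrite (@cartan_nabla_adapted c _ _ (dv k ga) (e_x R p j)); last 2 first.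
- by move=> x; rewrite of_adapted_y.
- by move=> x; rewrite of_adapted_x.
rewrite cartan_form_x linear_sum; apply: eq_bigr => i _.
by rewrite linearZ /= of_adapted_x metric_form_y.
Qed.

Lemma cartan_ty c v : img c v -> forall ga i al,
  cartan_nabla c (dt Gam c ga) (dy i al) v =
  \sum_(k < n) dt_form S Gam c v ga i k *: dy k al v -
  \sum_(et < p) christoffel h c.1 v.1.1 al et ga *: dy i et v.
Proof.
move=> /img_jetP[cv _] ga i al.
rewrite (@cartan_nabla_adapted c _ _ (e_t R n ga) (dv i al)); last 2 first.
- by move=> x; rewrite of_adapted_t.
- by move=> x; rewrite of_adapted_y.
rewrite cartan_form_y linearB; congr (_ - _); rewrite linear_sum;
  apply: eq_bigr => k _; rewrite linearZ /= of_adapted_y.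
  by rewrite metric_form_t.
by rewrite time_form_delta.
Qed.

Lemma cartan_xy c v k i al : cartan_nabla c (dx Gam c k) (dy i al) v =
  \sum_(l < n) dx_form S Gam c v k i l *: dy l al v.
Proof.
rewrite (@cartan_nabla_adapted c _ _ (e_x R p k) (dv i al)); last 2 first.
- by move=> x; rewrite of_adapted_x.
- by move=> x; rewrite of_adapted_y.
rewrite cartan_form_y time_form0 [X in _ - X]big1 => [|et _]; last first.
  by rewrite mxE scale0r.
rewrite subr0 linear_sum; apply: eq_bigr => l _.
by rewrite linearZ /= of_adapted_y metric_form_x.
Qed.

Lemma cartan_yy c v k ga i al : cartan_nabla c (dy k ga) (dy i al) v =
  \sum_(l < n) dy_form S c v k ga i l *: dy l al v.
Proof.
rewrite (@cartan_nabla_adapted c _ _ (dv k ga) (dv i al)); last 2 first.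
- by move=> x; rewrite of_adapted_y.
- by move=> x; rewrite of_adapted_y.
rewrite cartan_form_y time_form0 [X in _ - X]big1 => [|et _]; last first.
  by rewrite mxE scale0r.
rewrite subr0 linear_sum; apply: eq_bigr => l _.
by rewrite linearZ /= of_adapted_y metric_form_y.
Qed.

Definition cartan_connection : hnormal_connection h Gam :=
  @HNormal R p n T M h Gam cartan_linear_connection
    (fun c v k j ga => dt_form S Gam c v ga j k)
    (fun c v i j k => dx_form S Gam c v k j i)
    (fun c v i j k ga => dy_form S c v k ga j i)
    cartan_tt (fun c v _ => @cartan_xt c v) (fun c v _ => @cartan_yt c v)
    (fun c v _ => @cartan_tx c v) (fun c v _ => @cartan_xx c v)
    (fun c v _ => @cartan_yx c v) cartan_ty
    (fun c v _ => @cartan_xy c v) (fun c v _ => @cartan_yy c v).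

Lemma gml_symE c v i j : img c v -> g c v i j = g c v j i.
Proof. by move=> cv; rewrite -[in LHS](gml_sym S cv) mxE. Qed.

(** Brings g_(ij|k) to the matrix shape used by [koszul_metric] and [koszul_unique]; the second sum
    becomes a transpose by symmetry of [g]. *)
Lemma hcovE (D : hnormal_connection h Gam) c v i j k
    (L := \matrix_(b, a) cL D c v a b k) : img c v ->
  hcov g D c v i j k =
  ('D_(dx Gam c k v) (g c) v - (L *m g c v + (L *m g c v)^T)) i j.
Proof.
move=> cv; rewrite /hcov (derive_coord _ _ _ (gml_differentiable S cv)).
rewrite -addrA -opprD !mxE; congr (_ - (_ + _)); apply: eq_bigr => m _;
  by rewrite mxE// gml_symE.
Qed.

Lemma vcovE (D : hnormal_connection h Gam) c v i j k ga
    (C := \matrix_(b, a) cC D c v a b k ga) : img c v ->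
  vcov g D c v i j k ga =
  ('D_(dy k ga v) (g c) v - (C *m g c v + (C *m g c v)^T)) i j.
Proof.
move=> cv; rewrite /vcov (derive_coord _ _ _ (gml_differentiable S cv)).
rewrite -addrA -opprD !mxE; congr (_ - (_ + _)); apply: eq_bigr => m _;
  by rewrite mxE// gml_symE.
Qed.

Lemma cartan_metrical : g_metrical g cartan_connection.
Proof.
split=> c v cv i j k.
  rewrite hcovE//= (_ : \matrix_(b, a) _ = dx_form S Gam c v k).
    rewrite -(koszul_metric k (gml_unit S cv) (gml_sym S cv)
      (fun l => derive_gml_sym S _ cv)).
    by rewrite subrr mxE.
  by apply/matrixP => b a; rewrite mxE.
move=> ga; rewrite vcovE//= (_ : \matrix_(b, a) _ = dy_form S c v k ga).
  rewrite -(koszul_metric k (gml_unit S cv) (gml_sym S cv)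
    (fun l => derive_gml_sym S _ cv)).
  by rewrite subrr mxE.
by apply/matrixP => b a; rewrite mxE.
Qed.

(** Passing from the matrix product to the index formula of ii) uses the symmetry of both the
    inverse metric and its differentiated metric factor. *)
Lemma dt_formE c v ga j k : img c v ->
  dt_form S Gam c v ga j k =
  \sum_(i < n) invmx (g c v) k i / 2%:R *
    'D_(dt Gam c ga v) (fun w => g c w i j) v.
Proof.
move=> cv; rewrite /dt_form !mxE mulr_sumr; apply: eq_bigr => m _.
rewrite (derive_coord _ _ _ (gml_differentiable S cv)).
have -> : invmx (g c v) m k = invmx (g c v) k m.
  by rewrite -[in LHS](gml_sym S cv) -trmx_inv mxE.
rewrite -[in LHS](derive_gml_sym S _ cv) mxE.
by ring.
Qed.

Lemma cartan_conditions_cartan : cartan_conditions g cartan_connection.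
Proof.
split=> c v cv.
- by move=> k j ga; exact: dt_formE.
- move=> k i j; rewrite /= !mxE; apply: koszul_sym => l.
  exact: derive_gml_sym.
- move=> i j k ga; rewrite /= !mxE; apply: koszul_sym => l.
  exact: derive_gml_sym.
Qed.

End CartanConnection.

(** * Uniqueness *)

Section KoszulOperators.
Context {R : realType} {V : normedModType R} {X : Type} {A : atlas V X}.
Variables (c : chart A) (O : set V).
Hypotheses (oO : open O) (Oc : O `<=` img c).
Context {I : Type}.
Variable E : I -> V -> V.
Hypothesis sE : forall i, smooth_on O (E i).

Lemma nabla_suml (D : linear_connection A) (r : seq I) (y : I -> V -> R)
    (Z : V -> V) :
  (forall i, smooth_on O (y i)) -> smooth_on O Z ->
  {in O, D c (fun v => \sum_(i <- r) y i v *: E i v) Z =1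
         fun v => \sum_(i <- r) y i v *: D c (E i) Z v}.
Proof.
move=> sy sZ; elim: r => [|i r IHr] v vO.
  (* The value on the zero field comes from the scaling axiom, with that field written as the
     function 0 times [Z]. *)
  rewrite big_nil (_ : (fun v => _) = fun v => (fun=> 0 : R) v *: Z v).
    rewrite (nabla_scalel D oO Oc (smooth_on_cst O (0 : R)) sZ sZ vO).
    by rewrite scale0r.
  by apply/funext => x; rewrite big_nil scale0r.
have s1 : smooth_on O (fun v => y i v *: E i v) by exact: smooth_onZ.
have s2 : smooth_on O (fun v => \sum_(i <- r) y i v *: E i v).
  by apply: smooth_on_sum => // j _; exact: smooth_onZ.
rewrite big_cons (_ : (fun v => _) = (fun v => y i v *: E i v)
    + (fun v => \sum_(i <- r) y i v *: E i v)); last first.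
  by apply/funext => x; rewrite big_cons.
apply: etrans (nabla_addl D oO Oc s1 s2 sZ vO) _.
rewrite [in LHS]/GRing.add /= IHr//; congr (_ + _).
exact: (nabla_scalel D oO Oc (sy i) (sE i) sZ vO).
Qed.

Lemma nabla_sumr (D : linear_connection A) (r : seq I) (z : I -> V -> R)
    (Y : V -> V) :
  (forall i, smooth_on O (z i)) -> smooth_on O Y ->
  {in O, D c Y (fun v => \sum_(i <- r) z i v *: E i v) =1
         fun v => \sum_(i <- r)
           ('D_(Y v) (z i) v *: E i v + z i v *: D c Y (E i) v)}.
Proof.
move=> sz sY; elim: r => [|i r IHr] v vO.
  rewrite big_nil (_ : (fun v => _) = fun v => (fun=> 0 : R) v *: Y v).
    rewrite (nabla_leibniz D oO Oc (smooth_on_cst O (0 : R)) sY sY vO).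
    by rewrite derive_cst !scale0r addr0.
  by apply/funext => x; rewrite big_nil scale0r.
have s1 : smooth_on O (fun v => z i v *: E i v) by exact: smooth_onZ.
have s2 : smooth_on O (fun v => \sum_(i <- r) z i v *: E i v).
  by apply: smooth_on_sum => // j _; exact: smooth_onZ.
rewrite big_cons (_ : (fun v => _) = (fun v => z i v *: E i v)
    + (fun v => \sum_(i <- r) z i v *: E i v)); last first.
  by apply/funext => x; rewrite big_cons.
apply: etrans (nabla_addr D oO Oc sY s1 s2 vO) _.
rewrite [in LHS]/GRing.add /= IHr//; congr (_ + _).
exact: (nabla_leibniz D oO Oc (sz i) sY (sE i) vO).
Qed.

(** The expansions of [Y] and [Z] hold on [O] only, so locality first replaces the fields by the
    sums themselves. The derivative terms of the Leibniz rule do not depend on the connection, which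
    leaves the values on the frame. *)
Lemma nabla_frame_eq (D D' : linear_connection A) (r : seq I)
    (y z : I -> V -> R) (Y Z : V -> V) :
  (forall i, smooth_on O (y i)) -> (forall i, smooth_on O (z i)) ->
  (forall v, O v -> Y v = \sum_(i <- r) y i v *: E i v) ->
  (forall v, O v -> Z v = \sum_(i <- r) z i v *: E i v) ->
  (forall i j v, O v -> D c (E i) (E j) v = D' c (E i) (E j) v) ->
  {in O, D c Y Z =1 D' c Y Z}.
Proof.
move=> sy sz YE ZE DD'.
pose Y0 v := \sum_(i <- r) y i v *: E i v.
pose Z0 v := \sum_(i <- r) z i v *: E i v.
have sY0 : smooth_on O Y0.
  by apply: smooth_on_sum => // j _; exact: smooth_onZ.
have sZ0 : smooth_on O Z0.
  by apply: smooth_on_sum => // j _; exact: smooth_onZ.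
have YY0 : {in O, Y0 =1 Y} by move=> v /set_mem Ov; rewrite YE.
have ZZ0 : {in O, Z0 =1 Z} by move=> v /set_mem Ov; rewrite ZE.
move=> v vO; have Ov := set_mem vO.
rewrite -(nabla_local D oO Oc sY0 sZ0 YY0 ZZ0 vO).
rewrite -(nabla_local D' oO Oc sY0 sZ0 YY0 ZZ0 vO).
rewrite /Z0 (nabla_sumr D r sz sY0 vO) (nabla_sumr D' r sz sY0 vO).
apply: eq_bigr => j _; congr (_ + _ *: _).
rewrite /Y0 (nabla_suml D r sy (sE j) vO) (nabla_suml D' r sy (sE j) vO).
by apply: eq_bigr => i _; rewrite DD'.
Qed.

End KoszulOperators.

Section Uniqueness.
Context {R : realType} {p n : nat} {T : manifold R p} {M : manifold R n}.
Notation V := (jcoord R p n).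
Implicit Types (c : jchart T M) (v w u : V).

Section HNormal.
Variables (h : semiRiemannian T) (Gam : nonlinear_connection T M).

Definition adapted_frame c (i : 'I_p + 'I_n + 'I_n * 'I_p) : V -> V :=
  match i with
  | inl (inl al) => dt Gam c al
  | inl (inr k) => dx Gam c k
  | inr (k, al) => dy k al
  end.

Definition adapted_coord (w : V) (i : 'I_p + 'I_n + 'I_n * 'I_p) : R :=
  match i with
  | inl (inl al) => w.1.1 0 al
  | inl (inr k) => w.1.2 0 k
  | inr (k, al) => w.2 k al
  end.

Lemma adapted_frame_sum c v w :
  w = \sum_i adapted_coord (to_adapted Gam c v w) i *: adapted_frame c i v.
Proof.
rewrite !big_sumType /= -{1}(to_adaptedK Gam c v w).
rewrite {1}(jcoord_basis (to_adapted Gam c v w)) !linearD !linear_sum /=.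
congr (_ + _ + _).
- by apply: eq_bigr => al _; rewrite linearZ /= of_adapted_t.
- by apply: eq_bigr => al _; rewrite linearZ /= of_adapted_x.
transitivity (\sum_k \sum_al (to_adapted Gam c v w).2 k al *: dy k al v).
  apply: eq_bigr => k _; rewrite linear_sum; apply: eq_bigr => al _.
  by rewrite linearZ /= of_adapted_y.
by rewrite pair_bigA; apply: eq_bigr => -[].
Qed.

Lemma hnormal_operator_eq (D D' : hnormal_connection h Gam) c (O : set V)
    (Y Z : V -> V) :
  (forall v, img c v -> forall k j ga, cG D c v k j ga = cG D' c v k j ga) ->
  (forall v, img c v -> forall i j k, cL D c v i j k = cL D' c v i j k) ->
  (forall v, img c v -> forall i j k ga, cC D c v i j k ga = cC D' c v i j k ga) ->
  open O -> O `<=` img c -> smooth_on O Y -> smooth_on O Z ->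
  {in O, D c Y Z =1 D' c Y Z}.
Proof.
move=> GG' LL' CC' oO Oc sY sZ.
have sF i : smooth_on O (adapted_frame c i).
  case: i => [[al|k]|[k al]].
  - exact: smooth_on_dt.
  - exact: smooth_on_dx.
  - exact: smooth_on_cst.
have sC (W : V -> V) i : smooth_on O W ->
    smooth_on O (fun v => adapted_coord (to_adapted Gam c v (W v)) i).
  move=> /(smooth_on_to_adapted Gam oO Oc) sW.
  have s1 := smooth_on_fst oO (smooth_on_fst oO sW).
  have s2 := smooth_on_snd oO (smooth_on_fst oO sW).
  have s3 := smooth_on_snd oO sW.
  by case: i => [[al|k]|[k al]]; exact: smooth_on_coord.
apply: (nabla_frame_eq oO Oc sF (fun i => sC Y i sY) (fun i => sC Z i sZ)
  (fun v _ => adapted_frame_sum c v (Y v)) (fun v _ => adapted_frame_sum c v (Z v))).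
(* The nine pairs of frame vectors are the nine defining formulas of an h-normal connection. *)
move=> i j v /Oc cv; case: i => [[ga|k]|[k ga]]; case: j => [[al|j]|[j al]] /=.
- by rewrite !hn_tt.
- by rewrite !hn_tx//; apply: eq_bigr => l _; rewrite GG'.
- by rewrite !hn_ty//; congr (_ - _); apply: eq_bigr => l _; rewrite GG'.
- by rewrite !hn_xt.
- by rewrite !hn_xx//; apply: eq_bigr => l _; rewrite LL'.
- by rewrite !hn_xy//; apply: eq_bigr => l _; rewrite LL'.
- by rewrite !hn_yt.
- by rewrite !hn_yx//; apply: eq_bigr => l _; rewrite CC'.
- by rewrite !hn_yy//; apply: eq_bigr => l _; rewrite CC'.
Qed.

End HNormal.

Variables (S : gml_space T M) (Gam : nonlinear_connection T M).
Notation g := (gml_g S).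

Lemma cartan_connection_unique (D : hnormal_connection (gml_h S) Gam) :
  g_metrical g D -> cartan_conditions g D -> hn_eq (cartan_connection S Gam) D.
Proof.
move=> [hD vD] [GD LD CD].
have GG c v : img c v -> forall k j ga,
    cG (cartan_connection S Gam) c v k j ga = cG D c v k j ga.
  by move=> cv k j ga; rewrite GD//; exact: dt_formE.
have LL c v : img c v -> forall i j k,
    cL (cartan_connection S Gam) c v i j k = cL D c v i j k.
  move=> cv i j k; rewrite /= /dx_form.
  (* The matrices of coefficients L of [D] play the role of [T]: their symmetry is condition ii),
     and the metric equation is i) through [hcovE]. *)
  rewrite -(@koszul_unique _ _ (g c v) (fun l => 'D_(dx Gam c l v) (g c) v)
    (fun k => \matrix_(b, a) cL D c v a b k) (gml_unit S cv) (gml_sym S cv)).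
  - by rewrite mxE.
  - by move=> {}k {}j {}i; rewrite !mxE LD.
  move=> {}k; apply/eqP; rewrite -subr_eq0; apply/eqP/matrixP => a b.
  by rewrite -hcovE// hD// mxE.
(* The time index is a mere parameter, as the symmetry of C exchanges Latin indices; the argument
   for L is repeated for each [ga]. *)
have CC c v : img c v -> forall i j k ga,
    cC (cartan_connection S Gam) c v i j k ga = cC D c v i j k ga.
  move=> cv i j k ga; rewrite /= /dy_form.
  rewrite -(@koszul_unique _ _ (g c v) (fun l => 'D_(dv l ga) (g c) v)
    (fun k => \matrix_(b, a) cC D c v a b k ga) (gml_unit S cv) (gml_sym S cv)).
  - by rewrite mxE.
  - by move=> {}k {}j {}i; rewrite !mxE CD.
  move=> {}k; apply/eqP; rewrite -subr_eq0; apply/eqP/matrixP => a b.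
  by apply: etrans (esym (vcovE D a b k ga cv)) _; rewrite vD// mxE.
split=> // c O Y Z oO Oc sY sZ.
by apply: hnormal_operator_eq => // v cv; [exact: GG|exact: LL|exact: CC].
Qed.

End Uniqueness.

Theorem theorem2p1 (R : realType) (p n : nat) (T : manifold R p)
    (M : manifold R n) (S : gml_space T M) (Gam : nonlinear_connection T M) :
  exists D : hnormal_connection (gml_h S) Gam,
    [/\ g_metrical (gml_g S) D /\ cartan_conditions (gml_g S) D,
        forall D' : hnormal_connection (gml_h S) Gam,
          g_metrical (gml_g S) D' -> cartan_conditions (gml_g S) D' ->
          hn_eq D D',
        forall (c : jchart T M) (v : jcoord R p n), img c v ->
          forall i j k : 'I_n,
            cL D c v i j k =
            \sum_(m < n) invmx (gml_g S c v) i m / 2%:R *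
              ('D_(dx Gam c k v) (fun w => gml_g S c w m j) v +
               'D_(dx Gam c j v) (fun w => gml_g S c w m k) v -
               'D_(dx Gam c m v) (fun w => gml_g S c w j k) v)
      & forall (c : jchart T M) (v : jcoord R p n), img c v ->
          forall (i j k : 'I_n) (ga : 'I_p),
            cC D c v i j k ga =
            \sum_(m < n) invmx (gml_g S c v) i m / 2%:R *
              ('D_(dy k ga v) (fun w => gml_g S c w m j) v +
               'D_(dy j ga v) (fun w => gml_g S c w m k) v -
               'D_(dy m ga v) (fun w => gml_g S c w j k) v)].
Proof.
exists (cartan_connection S Gam); split.
- by split; [exact: cartan_metrical|exact: cartan_conditions_cartan].
- exact: cartan_connection_unique.
(* The explicit formulas are the definitions of [dx_form] and [dy_form], up to exchanging a
   derivative of the matrix [g] with that of its entries. *)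
- move=> c v cv i j k; have dg := gml_differentiable S cv.
  by rewrite /= mxE; apply: eq_bigr => m _; rewrite !(derive_coord _ _ _ dg).
move=> c v cv i j k ga; have dg := gml_differentiable S cv.
by rewrite /= mxE; apply: eq_bigr => m _; rewrite !(derive_coord _ _ _ dg).
Qed.
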